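(* Let $\mathcal H$ be a complex Hilbert space of (finite or infinite) dimension at least $2$, let $2\le k\le\dim\mathcal H$ be an integer, and let $c=(c_1,\dots,c_k)\in\mathbb R^k$ with $c_1\ge\dots\ge c_k$ and not all $c_i$ equal. Let $\Phi:\mathfrak B(\mathcal H)\to\mathfrak B(\mathcal H)$ be a surjective map (no linearity or continuity assumed) satisfying $W_c(\Phi(A)\Phi(B))=W_c(AB)$ for all $A,B\in\mathfrak B(\mathcal H)$. If $\sum_{i=1}^k c_i\neq 0$, then $\Phi$ has one of the following forms: (i) when $c_1+c_k\neq 0$: there are a unitary operator $U\in\mathfrak B(\mathcal H)$ and a sign $\varepsilon\in\{1,-1\}$ such that $\Phi(A)=\varepsilon UAU^*$ for all $A\in\mathfrak B(\mathcal H)$; (ii) when there exists an integer $p$ with $1<p<k$ such that $c_p+c_{k+1-p}\neq 0$ and $c_j+c_{k+1-j}=0$ for $j=1,\dots,p-1$: there are a unitary operator $U\in\mathfrak B(\mathcal H)$, a sign $\varepsilon\in\{1,-1\}$, and functions $\phi:\mathcal T\to\{-1,1\}$ and $\phi':\mathfrak B(\mathcal H)\to\{-1,1\}$ with $\phi'(A)\phi'(B)\in\mathrm{sgn}(AB)$ for all $A,B\in\mathfrak B(\mathcal H)$ and with $\phi'(A)=\varepsilon$ for all $A\in\mathfrak B(\mathcal H)\setminus\mathcal S$, such that $$\Phi(A)=\begin{cases}\phi(A)\,UAU^* & \text{if } A\in\mathcal T,\\ \phi'(A)\,UAU^* & \text{if } A\in\mathcal S\setminus\mathcal T,\\ \varepsilon\,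 UAU^* & \text{if } A\in\mathfrak B(\mathcal H)\setminus\mathcal S,\end{cases}$$ for all $A\in\mathfrak B(\mathcal H)$.
   Context: $\mathfrak B(\mathcal H)$ is the algebra of all bounded linear operators on $\mathcal H$. For $c=(c_1,\dots,c_k)\in\mathbb R^k$ with $k\le\dim\mathcal H$, the $c$-numerical range of $A\in\mathfrak B(\mathcal H)$ is $W_c(A)=\{\sum_{j=1}^k c_j\langle Ae_j,e_j\rangle:\{e_1,\dots,e_k\}\text{ an orthonormal subset of }\mathcal H\}$. Let $\mathcal S=\{A\in\mathfrak B(\mathcal H): W_c(A)=-W_c(A)\}$ (operators with symmetric $c$-numerical range) and $\mathcal T=\{A\in\mathcal S: AB\in\mathcal S\text{ and }BA\in\mathcal S\text{ for every }B\in\mathfrak B(\mathcal H)\}$. For an operator $C$, $\mathrm{sgn}(C)$ denotes the set $\{1\}$ if $C\notin\mathcal S$ and the set $\{-1,1\}$ if $C\in\mathcal S$. *)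

(* Defs.v *)
From HB Require Import structures.
From mathcomp Require Import all_boot all_order all_algebra.
From mathcomp Require Import complex.
From mathcomp Require Import all_classical all_reals all_analysis.

Set Implicit Arguments.
Unset Strict Implicit.
Unset Printing Implicit Defensive.

Import Order.TTheory GRing.Theory Num.Theory Num.Def.
Import numFieldNormedType.Exports.

Local Open Scope classical_set_scope.
Local Open Scope complex_scope.
Local Open Scope ring_scope.

HB.mixin Record isBoundedMap (K : numFieldType) (V W : normedModType K)
    (f : V -> W) := {
  bounded_map_subproof : exists M : K, forall x, `|f x| <= M * `|x|
}.

#[short(type="boundedLinear")]
HB.structure Definition BoundedLinear (K : numFieldType)
    (V W : normedModType K) :=
  {f of isBoundedMap K V W f & @GRing.Linear K V W *:%R f}.

Section BoundedLinearTheory.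
Variables (K : numFieldType).

Lemma boundedLinearP (V W : normedModType K) (f g : boundedLinear V W) :
  f =1 g -> f = g.
Proof.
case: f g => [f cf] [g cg] /= /funext fg; subst g; congr BoundedLinear.Pack.
case: cf cg => [[a] [b] [c]] [[a'] [b'] [c']].
by rewrite (Prop_irrelevance a a') (Prop_irrelevance b b')
  (Prop_irrelevance c c').
Qed.

Lemma bounded_comp_subproof (V1 V2 V3 : normedModType K)
    (f : boundedLinear V2 V3) (g : boundedLinear V1 V2) :
  exists M : K, forall x, `|(f \o g) x| <= M * `|x|.
Proof.
have [M fM] := @bounded_map_subproof _ _ _ f.
have [N gN] := @bounded_map_subproof _ _ _ g.
have [[x x0]|V0] := pselect (exists x : V2, x != 0); last first.
  exists 0 => x /=; have -> : g x = 0.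
    by apply/eqP/negPn/negP => gx0; apply: V0; exists (g x).
  by rewrite linear0 normr0 mul0r.
have M0 : 0 <= M.
  by rewrite -(@pmulr_lge0 _ `|x|) ?normr_gt0// (le_trans _ (fM x)).
exists (M * N) => y; rewrite -mulrA (le_trans (fM _))// ler_wpM2l//.
Qed.

HB.instance Definition _ (V1 V2 V3 : normedModType K)
    (f : boundedLinear V2 V3) (g : boundedLinear V1 V2) :=
  isBoundedMap.Build K V1 V3 (f \o g) (bounded_comp_subproof f g).

End BoundedLinearTheory.

Notation "''B' ( H )" := (boundedLinear H H) (format "''B' ( H )") : type_scope.

Definition comp_op (K : numFieldType) (H : normedModType K) (A B : 'B(H))
  : 'B(H) := A \o B.

Section NumericalRange.
Variables (R : realType) (H : completeNormedModType R[i]).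
Variable dot : {dot H for conjC}.

(* The dimension of H, finite or infinite, is at least k. *)
Definition dim_ge (k : nat) : Prop :=
  exists v : 'I_k -> H, forall a : 'I_k -> R[i],
    \sum_(j < k) a j *: v j = 0 -> forall j, a j = 0.

Definition is_adjoint (A B : 'B(H)) : Prop :=
  forall x y : H, dot (A x) y = dot x (B y).

(* U is unitary and V is its adjoint U^*; relational, so that the existence of
   adjoints of arbitrary bounded operators is not needed. *)
Definition unitary_adjoint (U V : 'B(H)) : Prop :=
  [/\ is_adjoint U V, forall x, V (U x) = x & forall x, U (V x) = x].

(* Enumerated orthonormal subsets {e_1, ..., e_k} are orthonormal k-tuples; dot is
   linear in its first argument and conjugate-linear in the second. *)
Definition numrange (k : nat) (c : k.-tuple R) (A : 'B(H)) : set R[i] :=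
  [set \sum_(j < k) (tnth c j)%:C * dot (A (tnth e j)) (tnth e j)
    | e in [set e : k.-tuple H | orthonormal dot e]].

Variables (k : nat) (c : k.-tuple R).

(* The class S of operators with symmetric c-numerical range. *)
Definition symops : set 'B(H) :=
  [set A | numrange c A = [set - z | z in numrange c A]].

(* The class T. *)
Definition absorbing_symops : set 'B(H) :=
  [set A | symops A /\
     forall B : 'B(H), symops (comp_op A B) /\ symops (comp_op B A)].

Definition signs : set R[i] := [set 1; -1].

Definition sgn_set (C : 'B(H)) : set R[i] :=
  if `[< symops C >] then signs else [set 1].

End NumericalRange.

(* Main.v *)
Require Import Defs.
From HB Require Import structures.
From mathcomp Require Import all_boot all_order all_algebra.
From mathcomp Require Import perm complex.
From mathcomp Require Import all_classical all_reals all_analysis.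
From mathcomp Require Import ring lra.

Set Implicit Arguments.
Unset Strict Implicit.
Unset Printing Implicit Defensive.

Import Order.TTheory GRing.Theory Num.Theory Num.Def.
Import numFieldNormedType.Exports.

Local Open Scope classical_set_scope.
Local Open Scope complex_scope.
Local Open Scope ring_scope.

(** Everything is read off from products whose value is a multiple of a rank-one
    projection, and only three facts about the range [W(A)] are used.

    First, exchanging two vectors of an orthonormal family that carry different
    weights shows that a function [g] whose weighted sums over orthonormal
    families all vanish is zero on unit vectors ([crange_zero]; the sum of the
    weights is nonzero).  Applied to [<A x, x>] it gives that [W(A) = {0}] only
    for [A = 0], applied to the imaginary part that [W(A)] is real only if the
    form of [A] is, and applied to [<A x, x> - 1] that [W(A) = W(1)] only for
    [A = 1].  Second, the largest modulus in [W(w \ox w)] is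
    [max |c_j| <w, w>] by Bessel's inequality ([crange_rank1_le]).  Hence, third,
    [W(v \ox w) = W(t y \ox y)] with [t] and [w] nonzero forces [<w, w> v] to be
    [t <y, y> w] or its opposite ([crange_rank1]).

    By the first fact [Phi] preserves zero products in both directions.  Inclusion
    of left annihilators compares ranges and inclusion of right annihilators
    compares kernels, so [Phi] preserves rank one, and [Phi (x \ox y)] has a range
    depending only on the line of [x] and a kernel depending only on the line of
    [y].  Since [(Phi 1)^2 = 1], rank-one projections go to plus or minus
    rank-one projections ([Phi_projection]).

    Fix a unit vector [e] with [Phi (e \ox e)] equal to [f \ox f] up to sign, and
    define [T] by [Phi (x \ox e) = T x \ox f].  The products of [e \ox y] and
    [x \ox e] are multiples of [e \ox e]; comparing ranges yields
    [<T x, T y> = <x, y>] up to sign ([vec_map_pm]).  Wigner's theorem for such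
    maps is elementary ([sign_wigner]): [T] is plus or minus a linear isometry
    [U], which is onto because [Phi] is.  Further products of rank-one operators
    give [Phi (x \ox y) = U x \ox U y] up to sign, and the range of
    [Phi A Phi (x \ox A x)], which is that of [A x \ox A x], gives
    [Phi A (U x) = U (A x)] up to a sign depending on [x].  A pointwise sign
    between two linear maps is constant, so [Phi A = U A U^*] up to a sign
    [sgn A] ([preserver_form]).

    Finally [W(A B) = sgn A sgn B W(A B)], so that [sgn A = sgn B] as soon as [A B]
    has a nonsymmetric range.  Taking [B = 1] gives the second form.  When
    [c_1 + c_k] is nonzero, rank-one projections have nonsymmetric ranges and
    connect every nonzero [A] to the identity ([sgn_const]), which gives the
    first form. *)

(** * Inner product identities *)

Definition sign_eq (V : zmodType) (a b : V) : Prop := a = b \/ a = - b.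

Section UpToSign.
Variable V : zmodType.
Implicit Types a b d : V.

Lemma sign_eq_refl a : sign_eq a a.
Proof. by left. Qed.

Lemma sign_eq_opp a : sign_eq (- a) a.
Proof. by right. Qed.

Lemma sign_eq_sym a b : sign_eq a b -> sign_eq b a.
Proof. by move=> [->|->]; [left|right; rewrite opprK]. Qed.

Lemma sign_eq_trans a b d : sign_eq a b -> sign_eq b d -> sign_eq a d.
Proof.
by move=> [->|->] // [->|->]; [right|left; rewrite opprK].
Qed.

Lemma sign_eq_morph (W : zmodType) (f : V -> W) a b :
  (forall x, f (- x) = - f x) -> sign_eq a b -> sign_eq (f a) (f b).
Proof. by move=> fN [->|->]; [left|right]. Qed.

Lemma sign_eq0 b : sign_eq 0 b -> b = 0.
Proof. by move=> [//|/eqP]; rewrite eq_sym oppr_eq0 => /eqP. Qed.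

End UpToSign.

Lemma sign_eqZ (K : nzRingType) (V : lmodType K) (a : K) (x y : V) :
  sign_eq x y -> sign_eq (a *: x) (a *: y).
Proof. by apply: sign_eq_morph => z; rewrite scalerN. Qed.

Lemma sign_eqM (K : nzRingType) (a x y : K) :
  sign_eq x y -> sign_eq (a * x) (a * y).
Proof. by apply: sign_eq_morph => z; rewrite mulrN. Qed.

Lemma sign_eq_mul (K : nzRingType) (a b x y : K) :
  sign_eq a b -> sign_eq x y -> sign_eq (a * x) (b * y).
Proof.
by move=> [->|->] [->|->]; rewrite ?mulrN ?mulNr ?opprK; by [left|right].
Qed.

Lemma sign_eqMI (K : idomainType) (a x y : K) :
  a != 0 -> sign_eq (a * x) (a * y) -> sign_eq x y.
Proof.
move=> a0 [|]; rewrite -?mulrN => /(mulfI a0) ->; by [left|right].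
Qed.

Section InnerProduct.
Variables (C : numClosedFieldType) (U : lmodType C) (dot : {dot U for conjC}).
Implicit Types (x y z u v w : U) (a b : C).

Lemma dotDl x y z : dot (x + y) z = dot x z + dot y z.
Proof. exact: linearDl. Qed.
Lemma dotDr x y z : dot z (x + y) = dot z x + dot z y.
Proof. exact: raddfD. Qed.
Lemma dotBl x y z : dot (x - y) z = dot x z - dot y z.
Proof. exact: linearBl. Qed.
Lemma dotBr x y z : dot z (x - y) = dot z x - dot z y.
Proof. exact: raddfB. Qed.
Lemma dotNl x z : dot (- x) z = - dot x z.
Proof. exact: linearNl. Qed.
Lemma dotNr x z : dot z (- x) = - dot z x.
Proof. exact: raddfN. Qed.
Lemma dotZl a x z : dot (a *: x) z = a * dot x z.
Proof. by rewrite linearZl_LR. Qed.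
Lemma dotZr a x z : dot z (a *: x) = a^* * dot z x.
Proof. by rewrite linearZr_LR. Qed.
Lemma dot0l z : dot 0 z = 0.
Proof. exact: linear0l. Qed.
Lemma dot0r z : dot z 0 = 0.
Proof. exact: raddf0. Qed.
Lemma dotC x y : (dot y x)^* = dot x y.
Proof. by rewrite [dot x y]hermC /= expr0 mul1r. Qed.

Lemma dot_suml I (r : seq I) (P : pred I) (F : I -> U) z :
  dot (\sum_(i <- r | P i) F i) z = \sum_(i <- r | P i) dot (F i) z.
Proof. exact: linear_sumlz. Qed.
Lemma dot_sumr I (r : seq I) (P : pred I) (F : I -> U) z :
  dot z (\sum_(i <- r | P i) F i) = \sum_(i <- r | P i) dot z (F i).
Proof. exact: raddf_sum. Qed.

Definition dotE := (dotBl, dotBr, dotDl, dotDr, dotNl, dotNr, dotZl, dotZr,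
  dot0l, dot0r).

Lemma dot_real x : (dot x x)^* = dot x x.
Proof. exact: dotC. Qed.

Lemma dot_eq0 x : dot x x = 0 -> x = 0.
Proof. by move=> /eqP; rewrite dnorm_eq0 => /eqP. Qed.

Lemma dot_neq0 x : x <> 0 -> dot x x != 0.
Proof. by move=> x0; apply/eqP => /dot_eq0. Qed.

Lemma dot_inj x : (forall y, dot x y = 0) -> x = 0.
Proof. by move=> x0; apply: dot_eq0. Qed.

Lemma dot_comm_neq0 x y : dot x y != 0 -> dot y x != 0.
Proof. by rewrite -dotC conjC_eq0. Qed.

(** The equality case of the Cauchy-Schwarz inequality. *)
Lemma eq_of_dot a u v : dot u u = a -> dot v v = a -> dot u v = a -> u = v.
Proof.
move=> uu vv uv; apply/eqP; rewrite -subr_eq0; apply/eqP/dot_eq0.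
have vu : dot v u = a by rewrite -dotC uv -uu dot_real.
by rewrite !dotE uu vv uv vu !subrr.
Qed.

Lemma sign_eq_of_dot u v :
  dot u u = dot v v -> sign_eq (dot u v) (dot v v) -> sign_eq u v.
Proof.
move=> uu [uv|uv]; first by left; exact: (eq_of_dot uu).
right; apply: (eq_of_dot uu); rewrite !dotE ?opprK //.
by rewrite uv opprK.
Qed.

Lemma proj_line u v :
  v <> 0 -> dot v v *: u - dot u v *: v = 0 -> u = (dot u v / dot v v) *: v.
Proof.
move=> /dot_neq0 v0 /eqP; rewrite subr_eq0 => /eqP e.
by rewrite mulrC -scalerA -e scalerA mulVf // scale1r.
Qed.

Lemma normalize x : x <> 0 -> exists a, a != 0 /\ dot (a *: x) (a *: x) = 1.
Proof.
move=> /dot_neq0 x0; have p : 0 < sqrtC (dot x x).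
  by rewrite sqrtC_gt0 lt_def x0 dnorm_ge0.
exists (sqrtC (dot x x))^-1; split; first by rewrite invr_eq0 gt_eqF.
rewrite !dotE conj_Creal ?rpredV ?gtr0_real //.
by rewrite mulrA -invfM -expr2 sqrtCK mulVf.
Qed.

(** Polarization over the complex numbers: if the quadratic form of [A] is real
    then [A] is Hermitian.  The real and imaginary parts of the mixed term are
    read off at [x + y] and [x + i y]. *)
Lemma polarization (A : {linear U -> U}) x y :
  (forall z, (dot (A z) z)^* = dot (A z) z) -> dot (A x) y = (dot (A y) x)^*.
Proof.
move=> r.
have h1 := r (x + y); have h2 := r (x + 'i *: y).
rewrite [A _]linearD !dotE !rmorphD /= (r x) (r y) in h1.
rewrite [A _]linearD [A ('i *: y)]linearZ /= !dotE !(rmorphD, rmorphM) /= !conjCK in h2.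
rewrite (r y) (r x) conjCi in h2.
set p := dot (A x) y in h1 h2 *; set q := dot (A y) x in h1 h2 *.
have e1 : p^* + q^* = p + q.
  set xx := dot _ x in h1; set yy := dot _ y in h1.
  apply: (addrI (xx + yy)).
  transitivity (xx + q^* + (p^* + yy)); first by ring.
  by rewrite h1; ring.
have e2 : p^* - q^* = q - p.
  set xx := dot _ x in h2; set yy := dot _ y in h2.
  apply: (mulfI (neq0Ci C)); pose t := xx - 'i * ('i * yy).
  transitivity (xx + - 'i * q^* + 'i * (p^* + - 'i * yy) - t).
    by rewrite /t; ring.
  by rewrite h2 /t; ring.
apply: (mulfI (_ : (2%:R : C) != 0)); first by rewrite pnatr_eq0.
transitivity ((p + q) - (q - p)); first by ring.
by rewrite -e1 -e2; ring.
Qed.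

Lemma polarization0 (A : {linear U -> U}) x :
  (forall z, dot (A z) z = 0) -> A x = 0.
Proof.
move=> A0; apply: dot_inj => y.
have s1 := A0 (x + y); have s2 := A0 (x + 'i *: y).
rewrite [A _]linearD !dotE !A0 add0r addr0 in s1.
rewrite [A _]linearD [A ('i *: y)]linearZ /= !dotE !A0 conjCi !mulr0 add0r addr0 in s2.
set p := dot _ y in s1 s2 *; set q := dot _ x in s1 s2.
have d : q - p = 0.
  apply: (mulfI (neq0Ci C)); rewrite mulr0.
  by transitivity ('i * q + - 'i * p); [ring | exact: s2].
apply: (mulfI (_ : (2%:R : C) != 0)); first by rewrite pnatr_eq0.
by transitivity ((q + p) - (q - p)); [ring | rewrite s1 d; ring].
Qed.

End InnerProduct.
(** * Maps preserving the inner product up to sign *)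

(** A vector space is not the union of two proper subspaces, here the kernels of
    [A - B] and [A + B]. *)
Lemma global_sign (V W : zmodType) (A B : {additive V -> W}) :
  (forall x, sign_eq (A x) (B x)) ->
  (forall x, A x = B x) \/ (forall x, A x = - B x).
Proof.
move=> AB; have [|] := pselect (forall x, A x = B x); first by left.
move=> /existsNP [x nx]; right => y.
have Ax : A x = - B x by case: (AB x).
have [//|Ay] : A y = - B y \/ A y = B y by case: (AB y); [right|left].
case: (AB (x + y)) => /eqP; rewrite !raddfD /= Ax Ay.
- by rewrite (inj_eq (addIr _)) => /eqP BN; case: nx; rewrite Ax.
- by rewrite (inj_eq (addrI _)) => /eqP.
Qed.

Section SignWigner.
Variables (C : numClosedFieldType) (U : lmodType C) (dot : {dot U for conjC}).
Implicit Types (x y z : U) (a : C).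

(** [L (a x + y) - a L x - L y] has norm zero, its square being an expression in
    inner products only. *)
Lemma isometry_linear (L : U -> U) :
  (forall x y, dot (L x) (L y) = dot x y) -> linear L.
Proof.
move=> iL a x y; apply: (@eq_of_dot _ _ dot (dot (a *: x + y) (a *: x + y))).
- exact: iL.
- by rewrite !dotE !iL.
- by rewrite 2!dotDr !dotZr !iL.
Qed.

Variables (T : U -> U) (e : U).
Hypothesis T_pm : forall x y, sign_eq (dot (T x) (T y)) (dot x y).
Hypothesis e_unit : dot e e = 1.

Lemma sign_isometry_norm x : dot (T x) (T x) = dot x x.
Proof.
case: (T_pm x x) => // Tx; apply/eqP.
have x0 := dnorm_ge0 dot x; have := dnorm_ge0 dot (T x).
rewrite Tx oppr_ge0 => x0'.
have -> : dot x x = 0 by apply/eqP; rewrite eq_le x0 x0'.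
by rewrite oppr0.
Qed.

Lemma sign_homogeneous a x : sign_eq (T (a *: x)) (a *: T x).
Proof.
apply: (sign_eq_of_dot (dot := dot)).
  by rewrite dnormZ !sign_isometry_norm dnormZ.
rewrite dnormZ sign_isometry_norm dotZr normCKC -mulrA.
apply: sign_eqM; rewrite -dotZl; exact: T_pm.
Qed.

(** [w] is [T y] with the sign that agrees with the one of [T e]. *)
Definition coherent y w := sign_eq (T y) w /\ sign_eq (T (e + y)) (T e + w).

(** After [T (e + y)] is given the sign that makes its product with [T e] equal to
    [1], its component [w] orthogonal to [T e] has the norm of [T y] and, up to
    sign, the product [<y, y>] with it; the equality case of the Cauchy-Schwarz
    inequality identifies the two vectors up to sign. *)
Lemma coherent_ex y : dot y e = 0 -> exists w, coherent y w.
Proof.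
move=> ye; have ey : dot e y = 0 by rewrite -dotC ye conjC0.
have [s [s1 Tey]] : exists s, sign_eq s (T (e + y)) /\ dot s (T e) = 1.
  have := T_pm (e + y) e; rewrite dotDl ye addr0 e_unit => -[Te|Te].
    by exists (T (e + y)); split=> //; exact: sign_eq_refl.
  exists (- T (e + y)); split; first exact: sign_eq_opp.
  by rewrite dotNl Te opprK.
have ss : dot s s = 1 + dot y y.
  have -> : dot s s = dot (T (e + y)) (T (e + y)).
    by case: s1 => ->; rewrite ?dotNl ?dotNr ?opprK.
  by rewrite sign_isometry_norm !dotE e_unit ye ey addr0 add0r.
have TeTy : dot (T e) (T y) = 0.
  by case: (T_pm e y); rewrite ey ?oppr0.
have Tes : dot (T e) s = 1 by rewrite -dotC Tey conjC1.
exists (s - T e); split; last by rewrite [T e + _]addrC subrK; exact: sign_eq_sym.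
apply: sign_eq_sym; apply: (sign_eq_of_dot (dot := dot)).
  rewrite !dotE ss Tey Tes !sign_isometry_norm e_unit.
  by rewrite subrr subr0 addrC addKr.
rewrite dotBl TeTy subr0 sign_isometry_norm.
have : sign_eq (dot s (T y)) (dot (T (e + y)) (T y)).
  by apply: (sign_eq_morph (f := fun z => dot z (T y)) _ s1) => z; rewrite dotNl.
move=> /sign_eq_trans; apply; have := T_pm (e + y) y.
by rewrite dotDl ey add0r.
Qed.

Lemma coherent_orth y w : dot y e = 0 -> coherent y w -> dot w (T e) = 0.
Proof.
move=> ye [Tw _]; have := T_pm y e; rewrite ye => /sign_eq_sym/sign_eq0 {}ye.
by case: Tw ye => ->; rewrite // dotNl => /eqP; rewrite oppr_eq0 => /eqP.
Qed.

(** If [<w, w'> = - <y, y'>] then [1 - <y, y'>] equals [1 + <y, y'>] up to sign,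
    which forces [<y, y'> = 0]. *)
Lemma coherent_dot y y' w w' : dot y e = 0 -> dot y' e = 0 ->
  coherent y w -> coherent y' w' -> dot w w' = dot y y'.
Proof.
move=> ye ye' cy cy'; have we := coherent_orth ye cy.
have we' := coherent_orth ye' cy'.
have ew' : dot (T e) w' = 0 by rewrite -dotC we' conjC0.
have ey' : dot e y' = 0 by rewrite -dotC ye' conjC0.
case: cy cy' => yw eyw [yw' eyw'].
have dot_pm (x1 x2 x3 x4 : U) : sign_eq x1 x2 -> sign_eq x3 x4 ->
    sign_eq (dot x1 x3) (dot x2 x4).
  by case=> ->; case=> ->; rewrite ?dotNl ?dotNr ?opprK; by [left|right].
have p1 : sign_eq (dot w w') (dot y y').
  by apply: sign_eq_trans (T_pm y y'); apply: sign_eq_sym; exact: dot_pm.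
have p2 : sign_eq (1 + dot w w') (1 + dot y y').
  have -> : 1 + dot w w' = dot (T e + w) (T e + w').
    by rewrite !dotE we ew' sign_isometry_norm e_unit addr0 add0r.
  have -> : 1 + dot y y' = dot (e + y) (e + y').
    by rewrite !dotE ye ey' e_unit addr0 add0r.
  by apply: sign_eq_trans (T_pm _ _); apply: sign_eq_sym; exact: dot_pm.
have two0 : (2%:R : C) != 0 by rewrite pnatr_eq0.
case: p1 => // ww; rewrite ww in p2 *; set d := dot y y' in p2 *.
case: p2 => p2.
- have -> : d = 0; last by rewrite oppr0.
  apply: (mulfI two0); rewrite mulr0.
  transitivity ((1 + d) - (1 - d)); first by ring.
  by rewrite p2; ring.
- suff : (2%:R : C) = 0 by move=> /eqP; rewrite (negbTE two0).
  transitivity ((1 - d) - (- (1 + d))); first by ring.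
  by rewrite p2; ring.
Qed.

(** Wigner's theorem for real phases.  Signs leave no room for an antiunitary
    [T], and comparing [T (e + y)] with [T e] and [T y] for [y] orthogonal to
    [e] selects the sign of [T y] in such a way that inner products are
    preserved exactly; an exact isometry is automatically linear. *)
Lemma sign_wigner :
  exists L : U -> U, (forall x y, dot (L x) (L y) = dot x y) /\
    forall x, sign_eq (T x) (L x).
Proof.
pose w y := xget 0 (coherent y).
have wP y : dot y e = 0 -> coherent y (w y).
  by move=> /coherent_ex [v yv]; exact: (xgetI 0 yv).
(* [q] is the orthogonal projection onto the complement of [e]. *)
pose q x := x - dot x e *: e.
have qe x : dot (q x) e = 0 by rewrite !dotE e_unit mulr1 subrr.
have oq x : dot e (q x) = 0 by rewrite -dotC qe conjC0.
have qK x : dot x e *: e + q x = x by rewrite addrC subrK.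
have qE x : q x = x - dot x e *: e by [].
clearbody q.
have we x : dot x e = 0 -> dot (w x) (T e) = 0.
  by move=> xe; exact: (coherent_orth xe (wP _ xe)).
have ew x : dot x e = 0 -> dot (T e) (w x) = 0.
  by move=> /we h; rewrite -dotC h conjC0.
pose L x := dot x e *: T e + w (q x).
have LL x y : dot (L x) (L y) = dot x y.
  rewrite -{2}(qK x) -{2}(qK y) /L !dotE we // ew // oq qe.
  rewrite (coherent_dot (qe x) (qe y) (wP _ (qe x)) (wP _ (qe y))).
  by rewrite sign_isometry_norm e_unit !mulr0 !mulr1 !addr0.
exists L; split=> // x; have [xe|xe] := eqVneq (dot x e) 0.
  rewrite /L qE xe !scale0r subr0 add0r.
  by have [] := wP _ xe.
(* By homogeneity up to sign the coordinate of [x] along [e] becomes [1]. *)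
have linL := isometry_linear LL.
have -> : x = dot x e *: (e + (dot x e)^-1 *: q x).
  by rewrite scalerDr scalerA mulfV // scale1r qK.
move: (dot x e) => a; set y := a^-1 *: q x.
have ye : dot y e = 0 by rewrite dotZl qe mulr0.
have -> : L (a *: (e + y)) = a *: L (e + y).
  have L0 : L 0 = 0.
    by apply: (dot_eq0 (dot := dot)); rewrite LL dot0l.
  by rewrite -[a *: _]addr0 linL L0 addr0.
apply: sign_eq_trans (sign_homogeneous _ _) _; apply: sign_eqZ.
have -> : L (e + y) = T e + w y.
  by rewrite /L qE dotDl e_unit ye addr0 !scale1r [e + y]addrC addrK.
by have [] := wP _ ye.
Qed.

End SignWigner.
(** * Orthonormal families and ranges of weighted sums *)

Section RankOne.
Variables (C : numClosedFieldType) (U : lmodType C) (dot : {dot U for conjC}).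

(** Denoted by [v \ox w] in what follows. *)
Definition rank1 (v w x : U) : U := dot x w *: v.

Lemma rank1_is_linear v w : linear (rank1 v w).
Proof. by move=> a x y; rewrite /rank1 dotDl dotZl scalerDl scalerA. Qed.

HB.instance Definition _ v w :=
  GRing.isLinear.Build C U U _ (rank1 v w) (rank1_is_linear v w).

End RankOne.

Section OrthonormalFamilies.
Variables (C : numClosedFieldType) (U : lmodType C) (dot : {dot U for conjC}).
Variable k : nat.
Implicit Types (x y u v w : U) (e : 'I_k -> U) (D : {set 'I_k}).

Definition orthonormal_on D e :=
  forall i j, i \in D -> j \in D -> dot (e i) (e j) = (i == j)%:R.

Definition orthonormal_family e := forall i j, dot (e i) (e j) = (i == j)%:R.

Lemma orthonormal_tupleP (t : k.-tuple U) :
  orthonormal dot t <-> orthonormal_family (tnth t).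
Proof.
split=> [/orthonormalP[ut ot] i j|ot].
  by rewrite ot ?mem_tnth // (inj_eq (elimT (tuple_uniqP _) ut)).
apply/orthonormalP; split.
  apply/tuple_uniqP => i j ij; apply/eqP; have := ot i j.
  by rewrite ij ot eqxx; case: (i == j) => // /eqP; rewrite oner_eq0.
move=> x y /tnthP[i ->] /tnthP[j ->]; rewrite ot; congr (_%:R).
case: eqP => [->|ij]; first by rewrite eqxx.
case: eqP => // tij; have := ot i j; rewrite tij ot eqxx.
by case: eqP ij => // _ _ /eqP; rewrite oner_eq0.
Qed.

Lemma onf_perm e (s : {perm 'I_k}) :
  orthonormal_family e -> orthonormal_family (e \o s).
Proof. by move=> oe i j /=; rewrite oe (inj_eq perm_inj). Qed.

Variable b : 'I_k -> U.
Hypothesis b_free : forall a : 'I_k -> C,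
  \sum_(j < k) a j *: b j = 0 -> forall j, a j = 0.

(** Otherwise the [k] independent vectors [b i] would be combinations of fewer
    than [k] vectors; the position [j0] outside [D] is a zero column of the matrix
    of coefficients, whose determinant therefore vanishes. *)
Lemma orthogonal_unit_ex D e j0 : orthonormal_on D e -> j0 \notin D ->
  exists u, dot u u = 1 /\ forall j, j \in D -> dot u (e j) = 0.
Proof.
move=> oe j0D; pose r i := b i - \sum_(j in D) dot (b i) (e j) *: e j.
have rD i j : j \in D -> dot (r i) (e j) = 0.
  move=> jD; rewrite /r dotBl dot_suml (bigD1 j) //= dotZl oe // eqxx mulr1.
  rewrite big1 ?addr0 ?subrr // => l /andP[lD lj].
  by rewrite dotZl oe // (negbTE lj) mulr0.
have [r0|/existsNP[i ri]] := pselect (forall i, r i = 0); last first.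
  have [a [_ a1]] := normalize dot ri.
  by exists (a *: r i); split=> // j jD; rewrite dotZl rD // mulr0.
pose M := \matrix_(i < k, j < k) (if j \in D then dot (b i) (e j) else 0).
have detM : \det M = 0.
  rewrite (expand_det_col _ j0) big1 // => i _.
  by rewrite mxE (negbTE j0D) mul0r.
have /eqP/det0P[a a0 aM] := detM.
suff az : a = 0 by rewrite az eqxx in a0.
apply/rowP => i; rewrite mxE; apply: (b_free (a := fun i => a 0 i)).
transitivity (\sum_(l < k) \sum_(j in D) (a 0 l * M l j) *: e j).
  apply: eq_bigr => l _; move: (r0 l) => /eqP; rewrite subr_eq0 => /eqP {1}->.
  rewrite scaler_sumr; apply: eq_bigr => j jD.
  by rewrite scalerA mxE jD.
rewrite exchange_big /= big1 // => j jD; rewrite -scaler_suml.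
have -> : \sum_(l < k) a 0 l * M l j = (a *m M) 0 j by rewrite mxE.
by rewrite aM mxE scale0r.
Qed.

Lemma orthonormal_extend D e : orthonormal_on D e ->
  exists e', (forall j, j \in D -> e' j = e j) /\ orthonormal_family e'.
Proof.
have [n] := ubnP #|~: D|; elim: n D e => // n IH D e Dn oe.
have [D1|[j0 j0D]] := set_0Vmem (~: D).
  have inD j : j \in D.
    by have := finset.in_set0 j; rewrite -D1 finset.in_setC => /negbFE.
  by exists e; split=> // i j; apply: oe.
rewrite finset.in_setC in j0D.
have [u [u1 uD]] := orthogonal_unit_ex oe j0D.
pose e1 j := if j == j0 then u else e j.
have [||e' [e'1 oe']] := IH (j0 |: D) e1.
- rewrite ltnS in Dn; apply: leq_trans Dn; apply: proper_card.
  apply/properP; split.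
    by apply/fintype.subsetP => j; rewrite !inE negb_or => /andP[].
  by exists j0; rewrite !inE ?eqxx.
- move=> i j; rewrite !inE /e1; case: (eqVneq i j0) => [->|ij0];
    case: (eqVneq j j0) => [->|jj0] //=.
  + by move=> _; exact: uD.
  + by move=> iD _; rewrite -dotC uD // conjC0 (negbTE ij0).
  + exact: oe.
exists e'; split=> // j jD; rewrite e'1 ?inE ?jD ?orbT // /e1.
by case: eqP => // jj; rewrite -jj jD in j0D.
Qed.

Lemma orthonormal_extend1 j0 x : dot x x = 1 ->
  exists e, e j0 = x /\ orthonormal_family e.
Proof.
move=> x1; have [|e [eD oe]] := @orthonormal_extend [set j0] (fun=> x).
  by move=> i j; rewrite !inE => /eqP-> /eqP->; rewrite eqxx.
by exists e; split=> //; rewrite eD ?inE.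
Qed.

Lemma orthonormal_extend2 i0 j0 x y : i0 != j0 ->
  dot x x = 1 -> dot y y = 1 -> dot x y = 0 ->
  exists e, [/\ e i0 = x, e j0 = y & orthonormal_family e].
Proof.
move=> ij x1 y1 xy; have yx : dot y x = 0 by rewrite -dotC xy conjC0.
pose f i := if i == i0 then x else y.
have [|e [eD oe]] := @orthonormal_extend [set i0; j0] f.
  move=> i j; rewrite !inE /f => /orP[]/eqP-> /orP[]/eqP->;
    by rewrite ?eqxx ?(negbTE ij) // eq_sym (negbTE ij).
exists e; split=> //; rewrite eD ?inE ?eqxx ?orbT // /f ?eqxx //.
by rewrite eq_sym (negbTE ij).
Qed.

Lemma bessel e w : orthonormal_family e ->
  \sum_(j < k) `|dot w (e j)| ^+ 2 <= dot w w.
Proof.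
move=> oe; set p := \sum_(j < k) dot w (e j) *: e j.
have wp : dot w p = \sum_(j < k) `|dot w (e j)| ^+ 2.
  rewrite dot_sumr; apply: eq_bigr => j _.
  by rewrite dotZr mulrC -normCK.
have pp : dot p p = dot w p.
  rewrite !dot_sumr; apply: eq_bigr => j _.
  rewrite !dotZr; congr (_ * _); rewrite dot_suml (bigD1 j) //=.
  rewrite dotZl oe eqxx mulr1 big1 ?addr0 // => i ij.
  by rewrite dotZl oe (negbTE ij) mulr0.
rewrite -wp -subr_ge0; clearbody p; have := dnorm_ge0 dot (w - p).
have pw : dot p w = dot w p by rewrite -dotC -pp dot_real.
by rewrite !dotE pp pw subrr addr0.
Qed.

Variables (c : 'I_k -> C).

(** The [c]-numerical range of [A] is the case [g x = <A x, x>]; other functions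
    [g] serve to test whether the form of [A] is real or constant. *)
Definition crange (g : U -> C) : set C :=
  [set z | exists e, orthonormal_family e /\ z = \sum_(j < k) c j * g (e j)].

Lemma crangeP g e :
  orthonormal_family e -> crange g (\sum_(j < k) c j * g (e j)).
Proof. by exists e. Qed.

Variables i0 j0 : 'I_k.
Hypothesis c_ij : c i0 != c j0.
Hypothesis c_sum : \sum_j c j != 0.

Let ij_neq : i0 != j0.
Proof. by apply: contraNneq c_ij => ->. Qed.

(** Exchanging the vectors at two positions with different weights shows that
    [g] takes the same value at any two orthogonal unit vectors, so that each
    weighted sum is the sum of the weights times a value of [g]. *)
Lemma crange_zero g : (forall z, crange g z -> z = 0) ->
  forall x, dot x x = 1 -> g x = 0.
Proof.
move=> g0 x x1.
have gorth y : dot y y = 1 -> dot x y = 0 -> g y = g x.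
  move=> y1 xy; have [e [ex ey oe]] := orthonormal_extend2 ij_neq x1 y1 xy.
  have h1 := g0 _ (crangeP g oe).
  have h2 := g0 _ (crangeP g (onf_perm (tperm i0 j0) oe)).
  have ji : j0 != i0 by rewrite eq_sym.
  rewrite (bigD1 i0) //= (bigD1 j0) //= ex ey in h1.
  rewrite (bigD1 i0) //= (bigD1 j0) //= tpermL tpermR ex ey in h2.
  have h3 : \sum_(i < k | (i != i0) && (i != j0)) c i * g (e (tperm i0 j0 i)) =
     \sum_(i < k | (i != i0) && (i != j0)) c i * g (e i).
    by apply: eq_bigr => i /andP[ii ij]; rewrite tpermD // eq_sym.
  rewrite h3 in h2; apply/eqP; rewrite eq_sym -subr_eq0; apply/eqP.
  apply: (mulfI (_ : c i0 - c j0 != 0)); first by rewrite subr_eq0.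
  rewrite mulr0; set S := \sum_(i < k | _) _ in h1 h2.
  transitivity ((c i0 * g x + (c j0 * g y + S)) - (c i0 * g y + (c j0 * g x + S))).
    by ring.
  by rewrite h1 h2 subrr.
have [e [ex oe]] := orthonormal_extend1 i0 x1.
have := g0 _ (crangeP g oe); rewrite (eq_bigr (fun j => c j * g x)) => [|j _].
  by rewrite -mulr_suml => /eqP; rewrite mulf_eq0 (negbTE c_sum) => /eqP.
have [->|ji] := eqVneq j i0; first by rewrite ex.
by rewrite gorth // -?ex oe ?eqxx // eq_sym (negbTE ji).
Qed.

(** The largest modulus of a weighted sum for [rank1 w w] is [dot w w] times the
    largest modulus of a weight: Bessel's inequality bounds it, and a family with
    a multiple of [w] at the position of that weight attains it. *)
Lemma crange_rank1_le (s t : C) y w :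
  crange (fun x => s * (dot x w * dot w x)) =
    crange (fun x => t * (dot x y * dot y x)) ->
  `|t| * dot y y <= `|s| * dot w w.
Proof.
move=> E; have [->|y0] := pselect (y = 0).
  by rewrite dot0l mulr0 mulr_ge0.
have real_norm j : `|c j| \is Num.real by rewrite normr_real.
have [m cm] : exists m, forall j, `|c j| <= `|c m|.
  have [m _ mP] := @real_arg_maxP C 'I_k i0 xpredT (fun j => `|c j|)
    isT (fun j _ => real_norm j).
  by exists m => j; apply: mP.
have cm0 : 0 < `|c m|.
  rewrite lt_def normr_ge0 andbT normr_eq0; apply: contraNneq c_ij => cm0.
  have z j : c j = 0 by apply/eqP; have := cm j; rewrite cm0 normr0 normr_le0.
  by rewrite !z.
have [a [a0 a1]] := normalize dot y0.
have [e [em oe]] := orthonormal_extend1 m a1.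
have := crangeP (fun x => t * (dot x y * dot y x)) oe; rewrite -E.
have ye : y = a^-1 *: e m by rewrite em scalerA mulVf // scale1r.
rewrite (bigD1 m) //= big1 ?addr0 => [|j jm]; last first.
  have -> : dot (e j) y = 0 by rewrite ye dotZr oe (negbTE jm) mulr0.
  by rewrite mul0r !mulr0.
have -> : dot (e m) y * dot y (e m) = dot y y.
  by rewrite ye !dotE oe eqxx !mulr1 mulrC.
move=> [f [of_ Ef]].
rewrite -(ler_pM2l cm0); have -> : `|c m| * (`|t| * dot y y) = `|c m * (t * dot y y)|.
  by rewrite !normrM (ger0_norm (dnorm_ge0 _ _)).
rewrite Ef; apply: le_trans (ler_norm_sum _ _ _) _.
apply: (@le_trans _ _ (\sum_(j < k) `|c m| * `|s| * `|dot w (f j)| ^+ 2)).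
  apply: ler_sum => j _; rewrite !normrM -[dot (f j) w]dotC norm_conjC -expr2 -mulrA.
  by apply: ler_wpM2r; rewrite ?cm // mulr_ge0 // exprn_ge0.
rewrite -mulr_sumr -mulrA.
by apply: ler_wpM2l => //; apply: ler_wpM2l => //; exact: bessel.
Qed.

(** If every [c j] is on the side of [- c m] where [c m] lies, then [- c m] is not a
    convex combination of the weights and zero.  By Bessel's inequality the range of
    a rank-one projection consists of such combinations, and it contains [c m], so
    that it is not symmetric. *)
Lemma crange_rank1_asym m (t : C) y : (forall j, 0 < c m * (c m + c j)) ->
  t != 0 -> y <> 0 ->
  crange (fun x => t * (dot x y * dot y x)) (- (t * (c m * dot y y))) -> False.
Proof.
move=> cm t0 y0 [e [oe]]; pose w j := `|dot y (e j)| ^+ 2.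
have w0 j : 0 <= w j by rewrite exprn_ge0.
have -> : \sum_(j < k) c j * (t * (dot (e j) y * dot y (e j))) =
    t * \sum_(j < k) c j * w j.
  rewrite mulr_sumr; apply: eq_bigr => j _.
  by rewrite mulrCA -[dot (e j) y]dotC /w normCKC.
rewrite -mulrN => /(mulfI t0) E.
have cm2 : 0 < c m * c m.
  by have := cm m; rewrite mulrDr -mulr2n pmulrn_lgt0.
have S0 : 0 <= \sum_(j < k) c m * (c m + c j) * w j.
  by apply: sumr_ge0 => j _; apply: mulr_ge0 => //; exact: ltW.
have D0 : 0 <= c m * c m * (dot y y - \sum_(j < k) w j).
  by apply: mulr_ge0; [exact: ltW | rewrite subr_ge0; exact: bessel].
have DS : c m * c m * (dot y y - \sum_(j < k) w j) +
    \sum_(j < k) c m * (c m + c j) * w j = 0.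
  rewrite [X in _ + X](eq_bigr (fun j => c m * c m * w j + c m * (c j * w j))) => [|j _].
    rewrite big_split /= -!mulr_sumr -E; ring.
  by ring.
have Sz : \sum_(j < k) c m * (c m + c j) * w j = 0.
  by apply/eqP; move/eqP: DS; rewrite paddr_eq0 // => /andP[].
have wz j : w j = 0.
  have := Sz => /eqP; rewrite psumr_eq0 => [/allP/(_ j (mem_index_enum _))|i _].
    by rewrite /= mulf_eq0 (gt_eqF (cm j)) => /eqP.
  by apply: mulr_ge0 => //; exact: ltW.
move: DS; rewrite Sz addr0 (eq_bigr (fun=> 0)) // big1_eq subr0 => /eqP.
by rewrite mulf_eq0 (gt_eqF cm2) (negbTE (dot_neq0 dot y0)).
Qed.

Hypothesis c_real : forall j, (c j)^* = c j.

Lemma crange_real g : (forall z, crange g z -> z^* = z) ->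
  forall x, dot x x = 1 -> (g x)^* = g x.
Proof.
move=> gr x x1; apply/eqP; rewrite -subr_eq0; apply/eqP.
apply: (crange_zero (g := fun x => (g x)^* - g x)) x1 => z [e [oe ->]].
under eq_bigr do rewrite mulrBr -{1}c_real -rmorphM.
by rewrite sumrB -rmorph_sum /= gr ?subrr //; exact: crangeP.
Qed.

(** Homogeneity reduces to unit vectors a property of the values of a quadratic
    form that is stable under nonnegative factors. *)
Lemma unit_quadratic (A : {linear U -> U}) (P : C -> Prop) :
  P 0 -> (forall a z : C, P z -> P (`|a| ^+ 2 * z)) ->
  (forall x, dot x x = 1 -> P (dot (A x) x)) -> forall x, P (dot (A x) x).
Proof.
move=> P0 PM Pu x; have [->|x0] := pselect (x = 0); first by rewrite dot0r.
have [a [a0 a1]] := normalize dot x0.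
have -> : x = a^-1 *: (a *: x) by rewrite scalerA mulVf // scale1r.
rewrite [A _]linearZ dotZl dotZr mulrA -normCK; exact/PM/Pu.
Qed.

Lemma crange_quadratic0 (A : {linear U -> U}) :
  (forall z, crange (fun x => dot (A x) x) z -> z = 0) -> forall x, A x = 0.
Proof.
move=> A0 x; apply: (polarization0 (dot := dot)).
apply: (unit_quadratic (A := A) (P := fun z => z = 0)) => //.
  by move=> a z ->; rewrite mulr0.
exact: crange_zero.
Qed.

(** A rank-one operator with the same range as a multiple [t] of a positive one
    is, up to sign, [t] times a positive one: divided by [t], its form is real,
    hence Hermitian, and the moduli are compared by [crange_rank1_le]. *)
Lemma crange_rank1 t v w y : t != 0 -> w <> 0 ->
  crange (fun x => dot (rank1 dot v w x) x) =
    crange (fun x => t * (dot x y * dot y x)) ->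
  sign_eq (dot w w *: v) ((t * dot y y) *: w).
Proof.
move=> t0 w0 E; have ww0 := dot_neq0 dot w0.
pose A x := rank1 dot (t^-1 *: v) w x.
have AE x : dot (A x) x = t^-1 * dot (rank1 dot v w x) x.
  by rewrite /A /rank1 !dotZl mulrCA.
have Areal x : (dot (A x) x)^* = dot (A x) x.
  move: x; apply: (unit_quadratic (A := rank1 dot (t^-1 *: v) w)
    (P := fun z => z^* = z)); first exact: conjC0.
    by move=> a z zz; rewrite rmorphM rmorphXn /= zz conj_normC.
  apply: crange_real => _ [e [oe ->]].
  have := crangeP (fun x => dot (rank1 dot v w x) x) oe; rewrite E.
  move=> [f [of_ Ef]].
  have -> : \sum_(j < k) c j * dot (rank1 dot (t^-1 *: v) w (e j)) (e j) =
      \sum_(j < k) c j * (dot (f j) y * dot y (f j)).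
    apply: (mulfI t0); rewrite !mulr_sumr; transitivity
      (\sum_(j < k) c j * dot (rank1 dot v w (e j)) (e j)).
      apply: eq_bigr => j _; rewrite [dot _ _]AE mulrCA.
      by rewrite [t * (t^-1 * _)]mulrA mulfV // mul1r.
    by rewrite Ef; apply: eq_bigr => j _; rewrite mulrCA.
  rewrite rmorph_sum; apply: eq_bigr => j _.
  by rewrite !rmorphM /= c_real !dotC [X in _ * X]mulrC.
have Aherm x : dot (A w) x = (dot (A x) w)^*.
  exact: (polarization (A := rank1 dot (t^-1 *: v) w)).
(* Hermitian symmetry at the pair [(w, x)] for all [x] puts [v] on the line of
   [w]. *)
pose m := dot w v / dot w w * (t / t^*).
have vE : v = m *: w.
  apply/eqP; rewrite -subr_eq0; apply/eqP/(dot_inj (dot := dot)) => x.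
  have := Aherm x; rewrite /A /rank1 !dotZl !rmorphM /= !dotC fmorphV /= => h.
  apply: (mulfI ww0); apply: (mulfI (_ : t^-1 != 0)); first by rewrite invr_eq0.
  rewrite !dotE [LHS]mulrA [LHS]mulrBr.
  have -> : t^-1 * dot w w * dot v x = dot w w * (t^-1 * dot v x) by ring.
  rewrite h /m; have tc0 : t^* != 0 by rewrite conjC_eq0.
  by rewrite !mulr0; field; rewrite ?ww0 ?t0 ?tc0.
clearbody m; have mt : (m / t)^* = m / t.
  have := Areal w; rewrite /A /rank1 vE !dotZl !rmorphM /= dot_real => h.
  apply: (mulfI ww0); apply: (mulIf ww0).
  transitivity (dot w w * ((t^-1)^* * (m^* * dot w w))); first by ring.
  by rewrite h; ring.
have Ev x : dot (rank1 dot v w x) x = m * (dot x w * dot w x).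
  by rewrite vE /rank1 !dotZl mulrCA.
have {}E : crange (fun x => m * (dot x w * dot w x)) =
    crange (fun x => t * (dot x y * dot y x)).
  by rewrite -E; congr crange; apply/funext => x.
have nmt : `|m| * dot w w = `|t| * dot y y.
  by apply/eqP; rewrite eq_le !crange_rank1_le.
rewrite vE scalerA.
have : `|m / t * dot w w| = dot y y.
  rewrite normrM normf_div (ger0_norm (dnorm_ge0 _ _)) mulrAC nmt.
  by rewrite mulrAC mulfV ?mul1r // normr_eq0.
have rr : m / t * dot w w \is Num.real.
  by apply: rpredM; [apply/CrealP | rewrite ger0_real ?dnorm_ge0].
have mE : dot w w * m = t * (m / t * dot w w) by field.
rewrite mE => <-; case: (real_ge0P rr) => _; first exact: sign_eq_refl.
by rewrite mulrN scaleNr; apply: sign_eq_sym; exact: sign_eq_opp.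
Qed.

End OrthonormalFamilies.
(** * Bounded operators and zero products *)

Section Operators.
Variables (K : numClosedFieldType) (H : normedModType K).
Variable dot : {dot H for conjC}.
Hypothesis norm_dot : forall x : H, `|x| ^+ 2 = dot x x.
Implicit Types (x y z u v w : H) (A B D : 'B(H)).

Lemma opZ A a x : A (a *: x) = a *: A x.
Proof. exact: linearZ. Qed.

Lemma opB A x y : A (x - y) = A x - A y.
Proof. exact: linearB. Qed.

Lemma opN A x : A (- x) = - A x.
Proof. exact: linearN. Qed.

Lemma op0 A : A 0 = 0.
Proof. exact: linear0. Qed.

Definition bounded_op (f : H -> H) (lf : linear f)
    (bf : exists M : K, forall x, `|f x| <= M * `|x|) : 'B(H) :=
  HB.pack f (GRing.isLinear.Build K H H _ f lf) (isBoundedMap.Build K H H f bf).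

Lemma cauchy_schwarz x w : `|dot x w| <= `|x| * `|w|.
Proof.
rewrite -(@ler_pXn2r _ 2) ?nnegrE ?mulr_ge0 // exprMn !norm_dot.
have [->|w0] := pselect (w = 0); first by rewrite !dot0r normr0 expr0n mulr0.
have ww : 0 < dot w w by rewrite lt_def dot_neq0 // dnorm_ge0.
rewrite -subr_ge0 -(pmulr_rge0 _ ww).
have := dnorm_ge0 dot (dot w w *: x - dot x w *: w).
have wx : dot w x = (dot x w)^* by rewrite dotC.
rewrite !dotE dot_real wx normCK => h; apply: le_trans h _.
by rewrite le_eqVlt; apply/orP; left; apply/eqP; ring.
Qed.

Lemma comp_opE A B x : comp_op A B x = A (B x).
Proof. by []. Qed.

Lemma id_is_linear : linear (@id H).
Proof. by []. Qed.

Lemma id_bounded : exists M : K, forall x : H, `|id x| <= M * `|x|.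
Proof. by exists 1 => x; rewrite mul1r. Qed.

Definition id_op : 'B(H) := bounded_op id_is_linear id_bounded.

Lemma rank1_bounded v w :
  exists M : K, forall x, `|rank1 dot v w x| <= M * `|x|.
Proof.
exists (`|w| * `|v|) => x; rewrite normrZ mulrAC; apply: ler_wpM2r => //.
by rewrite mulrC; exact: cauchy_schwarz.
Qed.

Definition tens v w : 'B(H) :=
  bounded_op (rank1_is_linear dot v w) (rank1_bounded v w).

(** The orthogonal projection onto the complement of [w], times [dot w w]. *)
Definition coproj_fun w x := dot w w *: x - dot x w *: w.

Lemma coproj_is_linear w : linear (coproj_fun w).
Proof.
move=> a x y; rewrite /coproj_fun dotDl dotZl scalerDr scalerDl !scalerBr.
by rewrite !scalerA [a * _]mulrC opprD addrACA.
Qed.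

Lemma coproj_bounded w :
  exists M : K, forall x, `|coproj_fun w x| <= M * `|x|.
Proof.
exists (dot w w + `|w| * `|w|) => x; apply: le_trans (ler_normB _ _) _.
rewrite !normrZ (ger0_norm (dnorm_ge0 _ _)) mulrDl lerD2l mulrAC.
by apply: ler_wpM2r => //; rewrite mulrC; exact: cauchy_schwarz.
Qed.

Definition coproj w : 'B(H) :=
  bounded_op (coproj_is_linear w) (coproj_bounded w).

Lemma tensE v w x : tens v w x = dot x w *: v.
Proof. by []. Qed.

Lemma coprojE w x : coproj w x = dot w w *: x - dot x w *: w.
Proof. by []. Qed.

Lemma coproj_self w : coproj w w = 0.
Proof. by rewrite coprojE subrr. Qed.

Definition zero_product A B : Prop := forall x, A (B x) = 0.

(** Inclusions of left and right annihilators.  They are the relations between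
    operators that a map preserving zero products can see: the first compares
    ranges, the second kernels. *)
Definition lann_sub A B := forall D, zero_product D A -> zero_product D B.
Definition rann_sub A B := forall D, zero_product A D -> zero_product B D.

Lemma coproj_range A v : dot v v = 1 -> zero_product (coproj v) A ->
  forall x, A x = dot (A x) v *: v.
Proof.
move=> v1 vA x; apply/eqP; rewrite -subr_eq0; apply/eqP.
by have := vA x; rewrite coprojE v1 scale1r.
Qed.

Lemma coproj_kernel A w : dot w w = 1 -> zero_product A (coproj w) ->
  forall x, A x = dot x w *: A w.
Proof.
move=> w1 wA x; apply/eqP; rewrite -subr_eq0; apply/eqP.
by have := wA x; rewrite coprojE w1 scale1r opB opZ.
Qed.

Lemma coproj_tens x y : zero_product (coproj x) (tens x y).
Proof. by move=> z; rewrite tensE opZ coproj_self scaler0. Qed.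

Lemma tens_coproj x y : zero_product (tens x y) (coproj y).
Proof.
by move=> z; rewrite tensE coprojE !dotE mulrC subrr scale0r.
Qed.

Lemma zero_product_tens D v w : w <> 0 -> zero_product D (tens v w) -> D v = 0.
Proof.
move=> /(dot_neq0 dot) w0 /(_ w); rewrite tensE opZ => /eqP.
by rewrite scaler_eq0 (negbTE w0) => /eqP.
Qed.

Lemma lann_tens a x y w : y <> 0 -> lann_sub (tens x y) (tens (a *: x) w).
Proof.
move=> y0 D /(zero_product_tens y0) Dx z.
by rewrite tensE !opZ Dx !scaler0.
Qed.

Lemma rann_tens a x y v : x <> 0 -> rann_sub (tens x y) (tens v (a *: y)).
Proof.
move=> x0 D Dy z; rewrite tensE dotZr; have := Dy z; rewrite tensE => /eqP.
by rewrite scaler_eq0 => /orP[/eqP->|/eqP//]; rewrite mulr0 scale0r.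
Qed.

(** Among nonzero operators the left annihilator is maximal exactly for rank one:
    it consists of the operators killing the range. *)
Definition lann_maximal A :=
  forall B, (exists x, B x <> 0) -> lann_sub A B -> lann_sub B A.

Lemma tens_lann_maximal x y : x <> 0 -> y <> 0 -> lann_maximal (tens x y).
Proof.
move=> x0 y0 B [z Bz] xB D DB u.
have := xB _ (coproj_tens x y) z; rewrite coprojE => /(proj_line x0) BE.
have := DB z; rewrite BE opZ => /eqP; rewrite scaler_eq0 => /orP[/eqP a0|].
  by case: Bz; rewrite BE a0 scale0r.
by rewrite tensE opZ => /eqP->; rewrite scaler0.
Qed.

Lemma lann_maximal_rank1 A : (exists x, A x <> 0) -> lann_maximal A ->
  exists v, dot v v = 1 /\ zero_product (coproj v) A.
Proof.
move=> [x Ax] mA; have [a [a0 a1]] := normalize dot Ax.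
exists (a *: A x); split=> //.
apply: (mA (tens (a *: A x) (a *: A x))); last exact: coproj_tens.
  exists (a *: A x); rewrite tensE a1 scale1r => /eqP.
  by rewrite scaler_eq0 (negbTE a0) => /eqP.
by move=> D DA z; rewrite tensE !opZ DA !scaler0.
Qed.

End Operators.
(** * Maps preserving the c-numerical range of products *)

Section Preserver.
Variables (K : numClosedFieldType) (H : normedModType K).
Variable dot : {dot H for conjC}.
Hypothesis norm_dot : forall x : H, `|x| ^+ 2 = dot x x.
Variables (k : nat) (b : 'I_k -> H).
Hypothesis b_free : forall a : 'I_k -> K,
  \sum_(j < k) a j *: b j = 0 -> forall j, a j = 0.
Variables (c : 'I_k -> K) (i0 j0 : 'I_k).
Hypothesis c_ij : c i0 != c j0.
Hypothesis c_sum : \sum_j c j != 0.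
Hypothesis c_real : forall j, (c j)^* = c j.
Implicit Types (x y u v w : H) (A B D : 'B(H)).

Definition op_range A := crange dot c (fun x => dot (A x) x).

Variable Phi : 'B(H) -> 'B(H).
Hypothesis Phi_surj : forall B, exists A, Phi A = B.
Hypothesis Phi_range : forall A B,
  op_range (comp_op (Phi A) (Phi B)) = op_range (comp_op A B).

Local Notation "v \ox w" := (tens norm_dot v w)
  (at level 40, left associativity).
Local Notation coproj := (coproj norm_dot).

Lemma op_range_eq A B : A =1 B -> op_range A = op_range B.
Proof. by move=> AB; congr crange; apply/funext => x; rewrite AB. Qed.

Lemma op_range0 A : (forall z, op_range A z -> z = 0) -> forall x, A x = 0.
Proof. exact: (crange_quadratic0 b_free c_ij c_sum). Qed.

Lemma zero_product_range A B z :
  zero_product A B -> op_range (comp_op A B) z -> z = 0.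
Proof.
move=> AB [e [_ ->]]; apply: big1 => j _.
by rewrite comp_opE AB dot0l mulr0.
Qed.

Lemma zero_product_Phi A B :
  zero_product (Phi A) (Phi B) <-> zero_product A B.
Proof.
split=> AB; apply: (op_range0 (A := comp_op _ _)) => z.
  by rewrite -Phi_range; exact: zero_product_range.
by rewrite Phi_range; exact: zero_product_range.
Qed.

Lemma lann_sub_Phi A B : lann_sub (Phi A) (Phi B) <-> lann_sub A B.
Proof.
split=> AB D.
  by move=> /zero_product_Phi DA; apply/zero_product_Phi; exact: AB.
have [D' <-] := Phi_surj D => /zero_product_Phi DA.
by apply/zero_product_Phi; exact: AB.
Qed.

Lemma rann_sub_Phi A B : rann_sub (Phi A) (Phi B) <-> rann_sub A B.
Proof.
split=> AB D.
  by move=> /zero_product_Phi DA; apply/zero_product_Phi; exact: AB.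
have [D' <-] := Phi_surj D => /zero_product_Phi DA.
by apply/zero_product_Phi; exact: AB.
Qed.

Lemma Phi_neq0 A : (exists x, Phi A x <> 0) <-> (exists x, A x <> 0).
Proof.
have [I' PI] := Phi_surj (id_op H).
split=> -[x Ax]; apply: contrapT => /forallNP A0.
  have : zero_product A I' by move=> y; apply: contrapT; exact: A0.
  by move=> /zero_product_Phi /(_ x); rewrite PI.
have : zero_product (Phi A) (Phi (id_op H)).
  by move=> y; apply: contrapT; exact: A0.
by move=> /zero_product_Phi /(_ x).
Qed.

Lemma lann_maximal_Phi A : lann_maximal A -> lann_maximal (Phi A).
Proof.
move=> mA B; have [B' <-] := Phi_surj B => /Phi_neq0 B0 /lann_sub_Phi AB.
by apply/lann_sub_Phi; exact: mA.
Qed.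

Lemma tens_neq0 x y : x <> 0 -> y <> 0 -> exists z, (x \ox y) z <> 0.
Proof.
move=> x0 /(dot_neq0 dot) y0; exists y; rewrite tensE => /eqP.
by rewrite scaler_eq0 (negbTE y0) => /eqP.
Qed.

Lemma unit_neq0 x : dot x x = 1 -> x <> 0.
Proof. by move=> x1 x0; move/eqP: x1; rewrite x0 dot0l eq_sym oner_eq0. Qed.

Lemma op_range_rank1 A t v w y : t != 0 -> w <> 0 ->
  (forall x, A x = dot x w *: v) -> op_range A = op_range ((t *: y) \ox y) ->
  sign_eq (dot w w *: v) ((t * dot y y) *: w).
Proof.
move=> t0 w0 AE E; apply: (crange_rank1 b_free c_ij c_sum c_real t0 w0).
have -> : (fun x => dot (rank1 dot v w x) x) = (fun x => dot (A x) x).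
  by apply/funext => x; rewrite AE.
have -> : (fun x => t * (dot x y * dot y x)) =
    (fun x => dot (((t *: y) \ox y) x) x).
  by apply/funext => x; rewrite tensE !dotZl mulrCA.
exact: E.
Qed.

Lemma Phi_id_involution x : Phi (id_op H) (Phi (id_op H) x) = x.
Proof.
pose J2 := comp_op (Phi (id_op H)) (Phi (id_op H)).
suff : (J2 \- idfun : {linear H -> H}) x = 0.
  by move=> /eqP; rewrite /= subr_eq0 => /eqP.
apply: (crange_quadratic0 b_free c_ij c_sum) => _ [e [oe ->]] /=.
have : op_range J2 (\sum_(j < k) c j * dot (J2 (e j)) (e j)).
  by exists e; split.
rewrite Phi_range => -[f [of_ Ef]].
rewrite (eq_bigr (fun j => c j * dot (J2 (e j)) (e j) - c j)) => [|j _].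
  rewrite sumrB Ef (eq_bigr c) ?subrr // => j _.
  by rewrite /= of_ eqxx mulr1.
by rewrite dotBl oe eqxx mulrBr mulr1.
Qed.

(** The image of a rank-one projection is plus or minus such a projection.
    With [Q = Phi (x \ox x)] and [v] spanning its range, [Q] is a functional
    times [v]; the real range of [Q^2] makes the functional proportional to
    [dot ^~ v], and the range of [Phi 1 Q], where [(Phi 1)^2 = 1], makes the
    factor a sign. *)
Lemma Phi_projection x : dot x x = 1 -> exists v (s : K),
  [/\ dot v v = 1, sign_eq s 1 & forall y, Phi (x \ox x) y = s *: (v \ox v) y].
Proof.
move=> x1; have x0 := unit_neq0 x1; set Q := Phi _.
have Q0 : exists y, Q y <> 0 by apply/Phi_neq0; exact: tens_neq0.
have [v [v1 vQ]] := lann_maximal_rank1 norm_dot Q0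
  (lann_maximal_Phi (tens_lann_maximal (norm_dot := norm_dot) x0 x0)).
have QE y := coproj_range v1 vQ y.
have v0 := unit_neq0 v1.
pose QQ := comp_op Q Q.
have QQE y : QQ y = (dot (Q y) v * dot (Q v) v) *: v.
  by rewrite comp_opE {1}(QE y) opZ {1}(QE v) scalerA.
have PP : op_range QQ = op_range ((1 *: x) \ox x).
  rewrite Phi_range; apply: op_range_eq => y.
  by rewrite comp_opE !tensE !dotZl x1 mulr1 scale1r.
have QQreal y : (dot (QQ y) y)^* = dot (QQ y) y.
  move: y; apply: (unit_quadratic (A := QQ) (P := fun z => z^* = z)).
  - exact: conjC0.
  - by move=> a z zz; rewrite rmorphM rmorphXn /= zz conj_normC.
  apply: (crange_real b_free c_ij c_sum c_real).
  rewrite -/(op_range QQ) PP => _ [e [_ ->]].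
  rewrite rmorph_sum; apply: eq_bigr => j _.
  by rewrite scale1r tensE dotZl !rmorphM /= c_real !dotC [X in _ * X]mulrC.
have Qvv : dot (Q v) v != 0.
  apply/eqP => Qv0; have : zero_product Q Q.
    by move=> y; have := QQE y; rewrite Qv0 mulr0 scale0r.
  move=> /zero_product_Phi /(_ x); rewrite !tensE x1 !scale1r x1 scale1r.
  exact: x0.
pose t := (dot (Q v) v)^* ^+ 2 / dot (Q v) v.
have Qt y : Q y = (t * dot y v) *: v.
  rewrite {1}QE; congr (_ *: _); apply: (mulIf Qvv).
  have : dot (QQ y) v = (dot (QQ v) y)^* := polarization (A := QQ) y v QQreal.
  rewrite !QQE !dotZl v1 mulr1 => ->.
  by rewrite !rmorphM /= [(dot v y)^*]dotC /t expr2; field.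
have t0 : t != 0 by rewrite mulf_neq0 ?invr_eq0 // expf_neq0 // conjC_eq0.
clearbody t; pose J := Phi (id_op H).
have Jv : sign_eq (t *: J v) v.
  have E : op_range (comp_op J Q) = op_range ((1 *: x) \ox x).
    by rewrite Phi_range scale1r.
  have JQ y : comp_op J Q y = dot y v *: (t *: J v).
    by rewrite comp_opE Qt opZ scalerA mulrC.
  have := op_range_rank1 (oner_neq0 _) v0 JQ E.
  by rewrite v1 x1 mulr1 !scale1r.
exists v, t; split=> // [|y]; last by rewrite tensE scalerA Qt.
have tt : t ^+ 2 = 1.
  have JJ : J (J v) = v := Phi_id_involution v.
  have : (t ^+ 2) *: v = v.
    rewrite expr2 -scalerA -{1}JJ -opZ.
    by case: Jv => e; rewrite e ?opN ?scalerN e ?opprK.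
  by move=> /(congr1 (dot^~ v)); rewrite dotZl v1 mulr1.
by move/eqP: tt; rewrite sqrf_eq1 => /orP[/eqP->|/eqP->]; [left|right].
Qed.

Lemma lann_Phi_tens A a x y w : y <> 0 ->
  zero_product A (Phi (x \ox y)) -> zero_product A (Phi ((a *: x) \ox w)).
Proof.
move=> y0; have /lann_sub_Phi h := lann_tens (norm_dot := norm_dot) a (x := x) w y0.
exact: h.
Qed.

Lemma rann_Phi_tens A a x y v : x <> 0 ->
  zero_product (Phi (x \ox y)) A -> zero_product (Phi (v \ox (a *: y))) A.
Proof.
move=> x0; have /rann_sub_Phi h := rann_tens (norm_dot := norm_dot) a (y := y) v x0.
exact: h.
Qed.

(** The range of [Phi (x \ox y)] is controlled by that of [Phi (u \ox u)], for [u] a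
    unit vector on the line of [x], and so is the kernel of [Phi (y \ox x)]; both
    are described by the same vector because [Phi (u \ox u)] is a projection up to
    sign. *)
Lemma Phi_line x : x <> 0 -> exists v, [/\ dot v v = 1,
  forall y, zero_product (coproj v) (Phi (x \ox y)) &
  forall y, zero_product (Phi (y \ox x)) (coproj v)].
Proof.
move=> /(normalize dot)[a [a0]]; set u := a *: x => u1.
have xu : x = a^-1 *: u by rewrite scalerA mulVf // scale1r.
have u0 := unit_neq0 u1; have [v [s [v1 _ PE]]] := Phi_projection u1.
have vP : zero_product (coproj v) (Phi (u \ox u)).
  by move=> y; rewrite PE opZ (coproj_tens norm_dot) scaler0.
have Pv : zero_product (Phi (u \ox u)) (coproj v).
  by move=> y; rewrite PE (tens_coproj norm_dot) scaler0.
exists v; split=> // y; rewrite xu.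
- exact: (lann_Phi_tens a^-1 y u0 vP).
- exact: (rann_Phi_tens a^-1 y u0 Pv).
Qed.

Section BasePoint.
Variables (e f : H) (s : K).
Hypothesis e_unit : dot e e = 1.
Hypothesis f_unit : dot f f = 1.
Hypothesis s_sign : sign_eq s 1.
Hypothesis Phi_e : forall x, Phi (e \ox e) x = s *: (f \ox f) x.

Let e0 : e <> 0 := unit_neq0 e_unit.
Let f0 : f <> 0 := unit_neq0 f_unit.

(** [Phi (x \ox e)] vanishes on the kernel of [Phi (e \ox e)], which is the
    complement of [f], hence is determined by its value at [f]. *)
Definition vec_map x := Phi (x \ox e) f.
Local Notation T := vec_map.

Lemma vec_mapE x y : Phi (x \ox e) y = dot y f *: T x.
Proof.
apply: (coproj_kernel f_unit); rewrite -{1}[e]scale1r.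
apply: (rann_Phi_tens 1 x e0) => z.
by rewrite Phi_e (tens_coproj norm_dot) scaler0.
Qed.

Lemma vec_map_base : T e = s *: f.
Proof. by rewrite /T Phi_e tensE f_unit scale1r. Qed.

Lemma vec_map0 : T 0 = 0.
Proof.
rewrite /T; apply: contrapT => T0; have [|x] := proj1 (Phi_neq0 (0 \ox e)).
  by exists f.
by rewrite tensE scaler0.
Qed.

(** The vector [w] with [Phi (e \ox y) = f \ox w] satisfies
    [<T x, w> = <x, y>] up to sign, because [Phi (e \ox y) Phi (x \ox e)] and
    [(e \ox y) (x \ox e)] are multiples of rank-one projections. *)
Lemma left_partner y : y <> 0 -> exists w,
  (forall x, Phi (e \ox y) x = dot x w *: f) /\
  (forall x, sign_eq (dot (T x) w) (dot x y)).
Proof.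
move=> y0; have [v [v1 _ vy]] := Phi_line y0.
have PE x : Phi (e \ox y) x = (dot x v * dot (Phi (e \ox y) v) f) *: f.
  rewrite {1}(coproj_kernel v1 (vy e)) -scalerA; congr (_ *: _).
  apply: (coproj_range f_unit); rewrite -{1}[e]scale1r.
  apply: (lann_Phi_tens 1 y e0) => z.
  by rewrite Phi_e opZ (coproj_tens norm_dot) scaler0.
pose w := (dot (Phi (e \ox y) v) f)^* *: v.
have PwE x : Phi (e \ox y) x = dot x w *: f.
  by rewrite PE /w dotZr conjCK mulrC.
clearbody w; exists w; split=> // x.
have [xy|xy] := eqVneq (dot x y) 0.
  have : zero_product (e \ox y) (x \ox e).
    by move=> z; rewrite !tensE dotZl xy mulr0 scale0r.
  move=> /zero_product_Phi /(_ f); rewrite vec_mapE f_unit scale1r PwE.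
  move=> /eqP; rewrite scaler_eq0 => /orP[/eqP->|/eqP//]; rewrite xy.
  exact: sign_eq_refl.
have E : op_range (comp_op (Phi (e \ox y)) (Phi (x \ox e))) =
    op_range ((dot x y *: e) \ox e).
  rewrite Phi_range; apply: op_range_eq => z.
  by rewrite comp_opE !tensE dotZl scalerA.
have AE z : comp_op (Phi (e \ox y)) (Phi (x \ox e)) z =
    dot z f *: (dot (T x) w *: f).
  by rewrite comp_opE vec_mapE opZ PwE.
have := op_range_rank1 xy f0 AE E; rewrite f_unit e_unit scale1r mulr1.
move=> /(sign_eq_morph (f := dot^~ f)) h.
have := h (fun z => dotNl dot z f).
by rewrite !dotZl f_unit !mulr1.
Qed.

(** Both vectors lie on the line attached to [y] by [Phi_line]: [T y] through the
    range of [Phi (y \ox e)], [w] through the kernel of [Phi (e \ox y)]. *)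
Lemma left_partner_line y w : y <> 0 ->
  (forall x, Phi (e \ox y) x = dot x w *: f) ->
  (forall x, sign_eq (dot (T x) w) (dot x y)) -> exists r, w = r *: T y.
Proof.
move=> y0 PwE Tw; have [v [v1 vy yv]] := Phi_line y0.
have Ty : T y = dot (T y) v *: v by exact: (coproj_range v1 (vy e)).
have wv : w = dot w v *: v.
  have : Phi (e \ox y) w = dot w v *: Phi (e \ox y) v.
    exact: (coproj_kernel v1 (yv e)).
  have w0 : w <> 0.
    move=> w0; have := Tw y; rewrite w0 dot0r => /sign_eq0/(dot_eq0 (dot := dot)).
    exact: y0.
  rewrite !PwE scalerA => /eqP; rewrite -subr_eq0 -scalerBl scaler_eq0.
  rewrite subr_eq0 => /orP[/eqP ww|/eqP//].
  have vw : dot v w = (dot w v)^* by rewrite dotC.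
  apply: (eq_of_dot (dot := dot) (a := dot w w)) => //.
    by rewrite !dotE v1 mulr1 ww vw.
  by rewrite dotZr mulrC ww vw.
have Tv0 : dot (T y) v != 0.
  apply/eqP => Tv0; have := Tw y; rewrite Ty Tv0 scale0r dot0l => /sign_eq0.
  by move/(dot_eq0 (dot := dot)).
exists (dot w v / dot (T y) v).
by rewrite {2}Ty scalerA divfK.
Qed.

(** The partner of [y] is [r T y], and [r] is a sign as soon as [<z, y>] is nonzero
    for some [z] whose own factor is a sign.  This holds for [z = e], and passes
    from [e] to a vector [y] orthogonal to it through [e + y]. *)
Lemma vec_map_pm x y : sign_eq (dot (T x) (T y)) (dot x y).
Proof.
pose good y := forall x, sign_eq (dot (T x) (T y)) (dot x y).
have good_sym z u : good z -> sign_eq (dot (T z) (T u)) (dot z u).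
  move=> /(_ u); rewrite -[dot (T z) _]dotC -[dot z u]dotC.
  by apply: sign_eq_morph => a; rewrite rmorphN.
have partner z : z <> 0 -> exists r : K,
    forall u, sign_eq (r * dot (T u) (T z)) (dot u z).
  move=> z0; have [w [PwE Tw]] := left_partner z0.
  have [r wr] := left_partner_line z0 PwE Tw.
  by exists r^* => u; rewrite -dotZr -wr.
have goodP z (r p q : K) : q != 0 -> sign_eq p q -> sign_eq (r * p) q ->
    (forall u, sign_eq (r * dot (T u) (T z)) (dot u z)) -> good z.
  move=> q0 pq rpq rz u; have r1 : sign_eq r 1.
    apply: (sign_eqMI q0); rewrite mulr1 mulrC; apply: sign_eq_trans rpq.
    by apply: sign_eqM; exact: sign_eq_sym.
  apply: sign_eq_trans (rz u); rewrite -{1}[dot _ _]mul1r.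
  by apply: sign_eq_mul; [exact: sign_eq_sym | exact: sign_eq_refl].
have ge : good e.
  have [r re] := partner e e0.
  apply: (goodP e r 1 1 (oner_neq0 _)) => //; first exact: sign_eq_refl.
  have := re e; rewrite mulr1 vec_map_base e_unit dnormZ f_unit.
  by case: s_sign => ->; rewrite ?normrN normr1 expr1n !mulr1.
have step z u : good z -> dot z u != 0 -> good u.
  move=> gz zu; have u0 : u <> 0 by move=> u0; rewrite u0 dot0r eqxx in zu.
  have [r rP] := partner u u0.
  exact: (goodP u r _ _ zu (good_sym _ _ gz) (rP z)).
have [->|y0] := pselect (y = 0); first by rewrite vec_map0 !dot0r; exact: sign_eq_refl.
have [ey|ey] := eqVneq (dot e y) 0; last exact: (step e y).
apply: (step (e + y) y); last by rewrite dotDl ey add0r dot_neq0.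
apply: (step e) => //; rewrite dotDr ey addr0 e_unit; exact: oner_neq0.
Qed.

Lemma vec_map_surj y : exists x, T x = y.
Proof.
have [A PA] := Phi_surj (y \ox f).
have rA : rann_sub (Phi (e \ox e)) (Phi A).
  rewrite PA => D De z; rewrite tensE; have := De z; rewrite Phi_e tensE.
  move=> /eqP; rewrite !scaler_eq0 => /or3P[|/eqP->|/eqP fz].
  - by case: s_sign => ->; rewrite ?oppr_eq0 oner_eq0.
  - by rewrite scale0r.
  - by case: (f0 fz).
have /rann_sub_Phi := rA => /(_ (coproj e) (tens_coproj norm_dot e e)).
move=> /(coproj_kernel e_unit) AE; exists (A e).
rewrite /T (_ : A e \ox e = A) ?PA ?tensE ?f_unit ?scale1r //.
by apply: boundedLinearP => x; rewrite tensE -AE.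
Qed.

(** [Phi (x \ox y)] is a multiple of [T x \ox T y] by comparison of ranges and
    kernels.  As [(x \ox y) (z \ox x) = <z, y> x \ox x], the factors at [(x, y)] and
    [(z, x)] are inverse up to sign when [<z, y>] is nonzero, and the factor at
    [(y, e)] is a sign by definition of [T].  This settles first the pairs whose
    first vector is not orthogonal to [e], then all pairs. *)
Lemma Phi_tens x y : x <> 0 -> y <> 0 ->
  exists l : K, sign_eq l 1 /\ forall z, Phi (x \ox y) z = (l * dot z (T y)) *: T x.
Proof.
pose scaled l x y := forall z, Phi (x \ox y) z = (l * dot z (T y)) *: T x.
have Tn x' : x' <> 0 -> T x' <> 0.
  move=> x0 Tx; have := vec_map_pm x' x'; rewrite Tx dot0l => /sign_eq0.
  by move/(dot_eq0 (dot := dot)).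
have scaled_ex x' y' : x' <> 0 -> y' <> 0 -> exists l, scaled l x' y'.
  move=> x0 y0; have [v [v1 vx _]] := Phi_line x0.
  have [w [w1 wy' wy]] := Phi_line y0.
  have TxE : T x' = dot (T x') v *: v by exact: (coproj_range v1 (vx e)).
  have TyE : T y' = dot (T y') w *: w by exact: (coproj_range w1 (wy' e)).
  have xv : dot (T x') v != 0.
    by apply/eqP => xv; apply: (Tn _ x0); rewrite TxE xv scale0r.
  have yw : (dot (T y') w)^* != 0.
    by rewrite conjC_eq0; apply/eqP => yw; apply: (Tn _ y0); rewrite TyE yw scale0r.
  exists (dot (Phi (x' \ox y') w) v / (dot (T x') v) / (dot (T y') w)^*) => z.
  rewrite (coproj_kernel w1 (wy x')) {1}(coproj_range v1 (vx y')) {2}TxE {2}TyE.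
  rewrite dotZr !scalerA; congr (_ *: _).
  by field; rewrite yw xv.
have inverse x' y' z l m : x' <> 0 -> dot z y' != 0 ->
    scaled l x' y' -> scaled m z x' -> sign_eq (l * m) 1.
  move=> x0 zy lE mE.
  have E : op_range (comp_op (Phi (x' \ox y')) (Phi (z \ox x'))) =
      op_range ((dot z y' *: x') \ox x').
    rewrite Phi_range; apply: op_range_eq => u.
    by rewrite comp_opE !tensE dotZl scalerA.
  have AE u : comp_op (Phi (x' \ox y')) (Phi (z \ox x')) u =
      dot u (T x') *: ((l * m * dot (T z) (T y')) *: T x').
    by rewrite comp_opE mE opZ lE !scalerA; congr (_ *: _); ring.
  have xx := dot_neq0 dot x0; have Txx := dot_neq0 dot (Tn _ x0).
  have TT : dot (T x') (T x') = dot x' x' := sign_isometry_norm vec_map_pm x'.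
  have := op_range_rank1 zy (Tn _ x0) AE E; rewrite TT scalerA.
  have Tpm (a d : K) : sign_eq (a *: T x') (d *: T x') -> sign_eq a d.
    by case=> /eqP; rewrite -?scaleNr -subr_eq0 -scalerBl scaler_eq0 subr_eq0 =>
      /orP[/eqP->|/eqP/(Tn _ x0)//]; [left|right].
  move=> /Tpm; rewrite [_ * dot x' x']mulrC => /(sign_eqMI xx) h.
  apply: (sign_eqMI zy); rewrite mulr1 mulrC; apply: sign_eq_trans h.
  by apply: sign_eqM; apply: sign_eq_sym; exact: vec_map_pm.
have base y' : scaled s y' e.
  move=> z; rewrite vec_mapE vec_map_base dotZr mulrA; congr (_ *: _).
  by case: s_sign => ->; rewrite -normCK ?normrN normr1 expr1n mul1r.
have sign_eq_inv (l m : K) : sign_eq (l * m) 1 -> sign_eq l 1 -> sign_eq m 1.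
  by move=> lm l1; apply: sign_eq_trans lm; rewrite -{1}[m]mul1r;
    apply: sign_eq_mul; [exact: sign_eq_sym | exact: sign_eq_refl].
have step x' y' z l m : x' <> 0 -> dot z y' != 0 ->
    scaled l x' y' -> scaled m z x' -> sign_eq m 1 -> sign_eq l 1.
  by move=> x0 zy lE mE; apply: sign_eq_inv; rewrite mulrC; exact: (inverse x' y' z).
have near_e z y' l : y' <> 0 -> dot z e != 0 -> scaled l z y' -> sign_eq l 1.
  by move=> y0 ze lE; apply: sign_eq_inv (inverse y' e z s l y0 ze (base y') lE) s_sign.
move=> x0 y0; have [l lE] := scaled_ex x y x0 y0.
exists l; split=> //.
(* [z] is [y], or [y + e] if [y] is orthogonal to [e]. *)
have [z [ze zy]] : exists z, dot z e != 0 /\ dot z y != 0.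
  have [ye|ye] := eqVneq (dot y e) 0; last by exists y; rewrite dot_neq0.
  exists (y + e); rewrite !dotDl ye add0r e_unit -[dot e y]dotC ye conjC0 addr0.
  by rewrite oner_neq0 dot_neq0.
have z0 : z <> 0 by move=> z0; rewrite z0 dot0l eqxx in zy.
have [m mE] := scaled_ex z x z0 x0.
exact: (step x y z l m x0 zy lE mE (near_e z x m x0 ze mE)).
Qed.

End BasePoint.

Lemma isometry_bounded (L : H -> H) :
  (forall x y, dot (L x) (L y) = dot x y) ->
  exists M : K, forall x, `|L x| <= M * `|x|.
Proof.
move=> iL; exists 1 => x; rewrite mul1r.
by rewrite -(@ler_pXn2r _ 2) ?nnegrE // !norm_dot iL.
Qed.

Lemma isometry_inverse (L : H -> H) :
  (forall x y, dot (L x) (L y) = dot x y) -> (forall y, exists x, L x = y) ->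
  exists U V : 'B(H), [/\ forall x, U x = L x,
    forall x y, dot (U x) y = dot x (V y),
    forall x, V (U x) = x & forall x, U (V x) = x].
Proof.
move=> iL sL; pose V y := xget 0 [set x | L x = y].
have LV y : L (V y) = y.
  by have [x xy] := sL y; exact: (xgetI 0 (xy : [set z | L z = y] x)).
have iV x y : dot (V x) (V y) = dot x y by rewrite -iL !LV.
exists (bounded_op (isometry_linear iL) (isometry_bounded iL)).
exists (bounded_op (isometry_linear iV) (isometry_bounded iV)).
split=> // [x y|x] /=; first by rewrite -{1}(LV y) iL.
apply: (eq_of_dot (dot := dot) (a := dot x x)) => //.
  by rewrite iV iL.
by rewrite -iL LV iL.
Qed.

(** The sign of [Phi A (U x)] relative to [U (A x)] is found by testing [Phi A] on
    the rank-one operator [x \ox A x], whose product with [A] is [A x \ox A x]. *)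
Lemma preserver_form : exists U V : 'B(H), [/\
  forall x y, dot (U x) y = dot x (V y),
  forall x, V (U x) = x, forall x, U (V x) = x &
  forall A, (forall x, Phi A x = U (A (V x))) \/
    (forall x, Phi A x = - U (A (V x)))].
Proof.
have [||e [e1 _]] := orthogonal_unit_ex b_free (D := finset.set0) (e := b)
    (j0 := i0) (dot := dot).
- by move=> i j; rewrite finset.in_set0.
- by rewrite finset.in_set0.
have [f [s [f1 s1 Pe]]] := Phi_projection e1.
have T_pm := vec_map_pm e1 f1 s1 Pe.
have T_surj := vec_map_surj e1 f1 s1 Pe.
have T_tens := Phi_tens e1 f1 s1 Pe.
have T_base := vec_mapE e1 f1 Pe.
move: (vec_map e f) T_pm T_surj T_tens T_base => T T_pm T_surj T_tens T_base.
have [L [iL TL]] := sign_wigner T_pm e1.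
have L0 : L 0 = 0 by apply: (dot_eq0 (dot := dot)); rewrite iL dot0l.
have [U [V [UL UV_adj VU UV]]] : exists U V : 'B(H), [/\ forall x, U x = L x,
    forall x y, dot (U x) y = dot x (V y),
    forall x, V (U x) = x & forall x, U (V x) = x].
  apply: isometry_inverse => // y; have [x <-] := T_surj y.
  case: (TL x) => ->; first by exists x.
  exists (- x); have linL := isometry_linear iL.
  by have := linL (-1) x 0; rewrite !addr0 L0 addr0 !scaleN1r.
exists U, V; split=> // A.
have AU x : sign_eq (Phi A (U x)) (U (A x)).
  have ATx : sign_eq (Phi A (U x)) (Phi A (T x)).
    by rewrite UL; apply: (sign_eq_morph (opN (Phi A))); apply: sign_eq_sym.
  have [Ax|Ax] := pselect (A x = 0).
    rewrite Ax op0; apply: sign_eq_trans ATx _.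
    have : zero_product A (x \ox e) by move=> z; rewrite tensE opZ Ax scaler0.
    move=> /zero_product_Phi /(_ f); rewrite T_base f1 scale1r => ->.
    exact: sign_eq_refl.
  have x0 : x <> 0 by move=> x0; rewrite x0 op0 in Ax.
  have [l [l1 PE]] := T_tens x (A x) x0 Ax; apply: sign_eq_trans ATx _.
  have TA : T (A x) <> 0.
    move=> TA; have := T_pm (A x) (A x); rewrite TA dot0l => /sign_eq0.
    by move/(dot_eq0 (dot := dot)).
  have E : op_range (comp_op (Phi A) (Phi (x \ox A x))) =
      op_range ((1 *: A x) \ox A x).
    rewrite Phi_range; apply: op_range_eq => z.
    by rewrite comp_opE !tensE opZ scale1r.
  have AE z : comp_op (Phi A) (Phi (x \ox A x)) z =
      dot z (T (A x)) *: (l *: Phi A (T x)).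
    by rewrite comp_opE PE opZ scalerA [l * _]mulrC.
  have := op_range_rank1 (oner_neq0 _) TA AE E.
  rewrite (sign_isometry_norm T_pm) mul1r => /(sign_eqZ (dot (A x) (A x))^-1).
  rewrite !scalerA mulVf ?dot_neq0 // !scale1r mul1r UL => h.
  apply: sign_eq_trans (TL _); apply: sign_eq_trans h.
  by case: l1 => ->; rewrite ?scaleN1r ?scale1r; [left|right; rewrite opprK].
have [h|h] := global_sign (A := comp_op (Phi A) U) (B := comp_op U A) AU.
  by left=> x; rewrite -[in LHS](UV x); exact: h.
by right=> x; rewrite -[in LHS](UV x); exact: h.
Qed.

End Preserver.
(** * Symmetric ranges and the choice of signs *)

Section Symmetric.
Variables (R : realType) (H : completeNormedModType R[i]).
Variable dot : {dot H for conjC}.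
Hypothesis norm_dot : forall x : H, `|x| ^+ 2 = dot x x.
Variables (k : nat) (c : k.-tuple R).
Implicit Types (x y : H) (A B : 'B(H)).

Definition complex_weight (j : 'I_k) : R[i] := (tnth c j)%:C.

Lemma complex_weight_real j : (complex_weight j)^* = complex_weight j.
Proof. exact: conjc_real. Qed.

Lemma numrangeE A : numrange dot c A = op_range dot complex_weight A.
Proof.
apply/seteqP; split=> [_ [t /orthonormal_tupleP ot <-]|_ [e [oe ->]]].
  by exists (tnth t); split.
exists [tuple e j | j < k].
  by apply/orthonormal_tupleP => i j; rewrite !tnth_mktuple; exact: oe.
by apply: eq_bigr => j _; rewrite tnth_mktuple.
Qed.

Lemma comp_id A : comp_op A (id_op H) = A.
Proof. exact: boundedLinearP. Qed.

Variables U V : 'B(H).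
Hypothesis U_adj : forall x y, dot (U x) y = dot x (V y).
Hypothesis VU : forall x, V (U x) = x.
Hypothesis UV : forall x, U (V x) = x.

(** Unitary invariance of the range, with a scalar factor. *)
Lemma numrange_conj A B (s : R[i]) : (forall x, A x = s *: U (B (V x))) ->
  numrange dot c A = [set s * z | z in numrange dot c B].
Proof.
move=> AB; rewrite !numrangeE.
have U_iso x y : dot (U x) (U y) = dot x y by rewrite U_adj VU.
have V_iso x y : dot (V x) (V y) = dot x y by rewrite -U_iso !UV.
have AE x : dot (A x) x = s * dot (B (V x)) (V x).
  by rewrite AB dotZl U_adj.
apply/seteqP; split=> [_ [e [oe ->]]|_ [_ [e [oe ->]] <-]].
  exists (\sum_(j < k) complex_weight j * dot (B (V (e j))) (V (e j))).
    by exists (V \o e); split=> // i j /=; rewrite V_iso.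
  by rewrite mulr_sumr; apply: eq_bigr => j _; rewrite AE mulrCA.
exists (U \o e); split=> [i j|] /=; first by rewrite U_iso.
by rewrite mulr_sumr; apply: eq_bigr => j _; rewrite AE VU mulrCA.
Qed.

Variable Phi : 'B(H) -> 'B(H).
Hypothesis Phi_range : forall A B : 'B(H),
  numrange dot c (comp_op (Phi A) (Phi B)) = numrange dot c (comp_op A B).
Variable sgn : 'B(H) -> R[i].
Hypothesis sgn_signs : forall A, signs (sgn A).
Hypothesis Phi_sgn : forall A x, Phi A x = sgn A *: U (A (V x)).

Lemma sgn_mul A B :
  ~ symops dot c (comp_op A B) -> sgn A * sgn B = 1.
Proof.
move=> nS; have E : numrange dot c (comp_op A B) =
    [set sgn A * sgn B * z | z in numrange dot c (comp_op A B)].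
  rewrite -{1}Phi_range; apply: numrange_conj => x.
  by rewrite !comp_opE !Phi_sgn !opZ VU scalerA.
have [] : sgn A * sgn B = 1 \/ sgn A * sgn B = -1.
- by case: (sgn_signs A) => ->; case: (sgn_signs B) => ->;
    rewrite ?mulN1r ?mul1r ?opprK; by [left|right].
- by [].
move=> sE; case: nS; rewrite /symops /= {1}E sE.
by congr image; apply/funext => z; rewrite mulN1r.
Qed.

Lemma sgn_eq A B : ~ symops dot c (comp_op A B) -> sgn A = sgn B.
Proof.
move=> /sgn_mul; case: (sgn_signs A) => ->; case: (sgn_signs B) => -> //.
  by rewrite mul1r.
by rewrite mulr1.
Qed.

Lemma sgn_nonsym A : ~ symops dot c A -> sgn A = sgn (id_op H).
Proof. by move=> nS; apply: sgn_eq; rewrite comp_id. Qed.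

Lemma sgn_set_mul A B : sgn_set dot c (comp_op A B) (sgn A * sgn B).
Proof.
rewrite /sgn_set; case: asboolP => [_|/sgn_mul->]; last by [].
by case: (sgn_signs A) => ->; case: (sgn_signs B) => ->;
  rewrite ?mulN1r ?mul1r ?opprK; by [left|right].
Qed.

Variable b : 'I_k -> H.
Hypothesis b_free : forall a : 'I_k -> R[i],
  \sum_(j < k) a j *: b j = 0 -> forall j, a j = 0.
Variable m : 'I_k.
Hypothesis c_m : forall j, 0 < tnth c m * (tnth c m + tnth c j).

Lemma tens_nonsym (t : R[i]) y : t != 0 -> y <> 0 ->
  ~ symops dot c (tens norm_dot (t *: y) y).
Proof.
move=> t0 y0 S.
have cm j : 0 < complex_weight m * (complex_weight m + complex_weight j).
  by rewrite /complex_weight -rmorphD -rmorphM ltcR.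
apply: (crange_rank1_asym (dot := dot) cm t0 y0).
have [a [a0 a1]] := normalize dot y0.
have [e [em oe]] := orthonormal_extend1 b_free m a1.
have ye : y = a^-1 *: e m by rewrite em scalerA mulVf // scale1r.
have G : (fun x => t * (dot x y * dot y x)) =
    (fun x => dot (tens norm_dot (t *: y) y x) x).
  by apply/funext => x; rewrite tensE !dotZl mulrCA.
rewrite G -/(op_range _ _ _) -numrangeE S.
exists (t * (complex_weight m * dot y y)) => //.
rewrite numrangeE; exists e; split=> //.
rewrite (bigD1 m) // big1 ?addr0 => [|j jm]; last first.
  by rewrite tensE {1}ye dotZr oe (negbTE jm) mulr0 scale0r dot0l mulr0.
have -> : dot y y = dot (e m) y * dot y (e m).
  by rewrite ye !dotE oe eqxx !mulr1 mulrC.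
by rewrite tensE !dotZl /= addr0; ring.
Qed.

(** If [<A x, x>] is nonzero then the successive products in the chain [A],
    [x \ox A x], [x \ox x], [1] are nonzero multiples of rank-one projections. *)
Lemma sgn_const A : (exists x, A x <> 0) -> sgn A = sgn (id_op H).
Proof.
move=> [z Az]; have [x Ax] : exists x, dot (A x) x != 0.
  apply: contrapT => /forallNP A0; apply: Az.
  by apply: (polarization0 (dot := dot)) => x; apply/eqP/negPn/negP; exact: A0.
have Ax0 : A x <> 0 by move=> h; rewrite h dot0l eqxx in Ax.
have x0 : x <> 0 by move=> h; rewrite h dot0r eqxx in Ax.
transitivity (sgn (tens norm_dot x (A x))).
  apply: sgn_eq; have -> : comp_op A (tens norm_dot x (A x)) =
      tens norm_dot (1 *: A x) (A x).
    by apply: boundedLinearP => y; rewrite comp_opE !tensE opZ scale1r.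
  by apply: tens_nonsym => //; exact: oner_neq0.
transitivity (sgn (tens norm_dot x x)).
  apply: sgn_eq; have -> : comp_op (tens norm_dot x (A x)) (tens norm_dot x x) =
      tens norm_dot (dot x (A x) *: x) x.
    by apply: boundedLinearP => y; rewrite comp_opE !tensE dotZl scalerA.
  by apply: tens_nonsym => //; exact: dot_comm_neq0.
apply: sgn_nonsym; rewrite -[X in tens _ X]scale1r.
by apply: tens_nonsym => //; exact: oner_neq0.
Qed.

End Symmetric.

(** A nonzero sum of the weights yields a nonzero [c_p + c_(k+1-p)]. *)
Lemma reflected_sum (R : zmodType) (k : nat) (c : k.-tuple R) :
  \sum_(1 <= p < k.+1) (c`_p.-1 + c`_(k - p)) = (\sum_(j < k) tnth c j) *+ 2.
Proof.
have cE : \sum_(j < k) tnth c j = \sum_(0 <= j < k) c`_j.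
  by rewrite big_mkord; apply: eq_bigr => j _; rewrite (tnth_nth 0).
rewrite big_add1 /= big_split /= mulr2n cE; congr (_ + _).
rewrite [RHS]big_nat_rev /=.
by apply: eq_bigr => j _; rewrite add0n.
Qed.

(* c_i is the i-th entry counted from 1, i.e. c`_i.-1; hence c_(k+1-p) is c`_(k - p). *)
Theorem corollary1p3 (R : realType) (H : completeNormedModType R[i])
    (dot : {dot H for conjC})
    (norm_dot : forall x : H, `|x| ^+ 2 = dot x x)
    (k : nat) (k_ge2 : (2 <= k)%N) (k_le_dim : dim_ge H k)
    (c : k.-tuple R)
    (c_noninc : forall i j : 'I_k, (i <= j)%N -> tnth c j <= tnth c i)
    (c_nonconst : exists i j : 'I_k, tnth c i != tnth c j)
    (Phi : 'B(H) -> 'B(H))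
    (Phi_surj : forall B, exists A, Phi A = B)
    (Phi_range : forall A B : 'B(H),
      numrange dot c (comp_op (Phi A) (Phi B)) = numrange dot c (comp_op A B))
    (c_sum : \sum_(j < k) tnth c j != 0) :
  (c`_0 + c`_k.-1 != 0 /\
   exists (U V : 'B(H)) (eps : R[i]),
     [/\ unitary_adjoint dot U V, signs eps &
         forall (A : 'B(H)) (x : H), Phi A x = eps *: U (A (V x))])
  \/
  ((exists p : nat,
      [/\ (1 < p < k)%N, c`_p.-1 + c`_(k - p) != 0 &
          forall j : nat, (1 <= j <= p.-1)%N -> c`_j.-1 + c`_(k - j) = 0]) /\
   exists (U V : 'B(H)) (eps : R[i]) (phi phi' : 'B(H) -> R[i]),
     [/\ unitary_adjoint dot U V,
         signs eps,
         forall A, absorbing_symops dot c A -> signs (phi A),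
         forall A, signs (phi' A) &
     [/\ forall A B, sgn_set dot c (comp_op A B) (phi' A * phi' B),
         forall A, ~ symops dot c A -> phi' A = eps,
         forall A, absorbing_symops dot c A ->
           forall x, Phi A x = phi A *: U (A (V x)),
         forall A, symops dot c A -> ~ absorbing_symops dot c A ->
           forall x, Phi A x = phi' A *: U (A (V x)) &
         forall A, ~ symops dot c A ->
           forall x, Phi A x = eps *: U (A (V x))]]).
Proof.
have [b b_free] := k_le_dim.
have [i0 [j0 c_ij]] := c_nonconst.
pose w := complex_weight c.
have w_ij : w i0 != w j0 by rewrite (inj_eq (@complexI R)).
have w_sum : \sum_j w j != 0.
  rewrite -(rmorph_sum (real_complex R)) /=.
  by apply: contraNneq c_sum => h; apply/eqP; apply: (@complexI R); exact: h.
have w_range A B : op_range dot w (comp_op (Phi A) (Phi B)) =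
    op_range dot w (comp_op A B) by rewrite -!numrangeE.
have [U [V [U_adj VU UV PhiE]]] := preserver_form norm_dot b_free w_ij w_sum
  (complex_weight_real c) Phi_surj w_range.
pose sgn A : R[i] := if `[< forall x, Phi A x = U (A (V x)) >] then 1 else -1.
have sgn_signs A : signs (sgn A).
  by rewrite /sgn; case: ifP => _; [left|right].
have Phi_sgn A x : Phi A x = sgn A *: U (A (V x)).
  rewrite /sgn; case: asboolP => [->|nA]; first by rewrite scale1r.
  by case: (PhiE A) => // ->; rewrite scaleN1r.
have UV_adj : unitary_adjoint dot U V by split.
have k0 : (0 < k)%N by apply: ltn_trans k_ge2.
have [c0k|c0k] := eqVneq (c`_0 + c`_k.-1) 0; last first.
  left; split=> //; exists U, V, (sgn (id_op H)); split=> // A x.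
  (* [m] is the position of the extreme weight of larger modulus. *)
  have [m cm] : exists m : 'I_k, forall j, 0 < tnth c m * (tnth c m + tnth c j).
    have k1 : (k.-1 < k)%N by rewrite prednK.
    pose first := Ordinal k0; pose last := Ordinal k1.
    have cF j : tnth c j <= tnth c first by apply: c_noninc.
    have cL j : tnth c last <= tnth c j.
      by apply: c_noninc; rewrite /= -ltnS prednK.
    have : tnth c first + tnth c last != 0 by rewrite !(tnth_nth 0).
    rewrite neq_lt => /orP[neg|pos].
      by exists last => j; have := cF j; have := cF last; nra.
    by exists first => j; have := cL j; have := cF last; nra.
  rewrite Phi_sgn; have [A0|/existsNP A0] := pselect (forall z, A z = 0).
    by rewrite A0 op0 !scaler0.
  congr (_ *: _); apply: (sgn_const norm_dot U_adj VU UV Phi_range sgn_signs Phi_sgn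
    b_free cm A0).
right; split; last first.
  exists U, V, (sgn (id_op H)), sgn, sgn; split=> //; split=> //.
  - by move=> A B; apply: (sgn_set_mul U_adj VU UV Phi_range sgn_signs Phi_sgn).
  - by move=> A; apply: (sgn_nonsym U_adj VU UV Phi_range sgn_signs Phi_sgn).
  - move=> A nS x; rewrite Phi_sgn; congr (_ *: _).
    by apply: (sgn_nonsym U_adj VU UV Phi_range sgn_signs Phi_sgn).
pose P p := (0 < p <= k)%N && (c`_p.-1 + c`_(k - p) != 0).
have [|p /andP[/andP[p0 pk] cp] p_min] := @ex_minnP P.
  apply: contrapT => /forallNP nP; move/negP: c_sum; apply.
  have : (\sum_(j < k) tnth c j) *+ 2 == 0; last by rewrite mulrn_eq0.
  rewrite -reflected_sum big_nat; apply/eqP/big1 => p p_range.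
  by have := nP p; rewrite /P -[(p <= k)%N]ltnS p_range => /negP/negPn/eqP.
have p1 : p != 1%N.
  by apply: contraNneq cp => ->; rewrite /= subn1 c0k.
have pk' : p != k.
  by apply: contraNneq cp => ->; rewrite subnn addrC c0k.
exists p; split=> //.
  by apply/andP; split; rewrite ltn_neqAle ?pk' ?pk // eq_sym p1 p0.
move=> j /andP[j0' jp]; apply/eqP; apply: contraT => cj.
have jltp : (j < p)%N by rewrite -(prednK p0) ltnS.
have : (p <= j)%N by apply: p_min; rewrite /P j0' cj (leq_trans (ltnW jltp)).
by rewrite leqNgt jltp.
Qed.
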